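(* Let $l,k\ge 1$ be integers, $n=l+k$, $X=Gr(l,\mathbb{C}^n)$, and let $\lambda,\mu\subseteq l\times k$ be partitions. Let $P$ be the set of all partitions $\rho$ such that $\rho_1\le k$, $c_{\lambda,\mu}^{\rho}\ne 0$ and $\mathrm{core}_n(\rho)\subseteq l\times k$, and let $r_0=\min_{\rho\in P} r_n(\rho)$ (equivalently, consider those $\rho\in P$ with the largest $n$-core). Then the contributions of the $\rho\in P$ with $r_n(\rho)=r_0$ to the rim hook formula $$\sigma_{\lambda}*\sigma_{\mu}=\sum_{\rho\in P} q^{r_n(\rho)}\,\epsilon(\rho)\,c_{\lambda,\mu}^{\rho}\,\sigma_{\mathrm{core}_n(\rho)}$$ do not cancel each other out, i.e. $$\sum_{\rho\in P,\ r_n(\rho)=r_0}\epsilon(\rho)\,c_{\lambda,\mu}^{\rho}\,\sigma_{\mathrm{core}_n(\rho)}\neq 0 .$$ In other words, $d_{\min}=r_0$: the smallest degree of $q$ that appears with nonzero coefficient in $\sigma_\lambda*\sigma_\mu$ equals the smallest degree of $q$ that appears in the right-hand side of the rim hook formula before cancellations.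
   Context: Partitions are identified with their Young diagrams. $l\times k$ denotes the rectangle with $l$ rows and $k$ columns; $\lambda\subseteq l\times k$ means that $\lambda$ has at most $l$ rows and $\lambda_1\le k$. $c_{\lambda,\mu}^{\rho}$ is the Littlewood-Richardson coefficient (for arbitrary partitions $\rho$, with any number of rows), and $|\rho|$ is the number of boxes of $\rho$. Quantum cohomology: $X=Gr(l,\mathbb{C}^n)$ is the Grassmannian of $l$-dimensional subspaces of $\mathbb{C}^n$. The (small) quantum cohomology ring $\mathrm{QH}^*(X)$ is a commutative associative $\mathbb{Z}[q]$-algebra, free as a $\mathbb{Z}[q]$-module with basis the Schubert classes $\{\sigma_\nu\}_{\nu\subseteq l\times k}$, with product $$\sigma_\lambda*\sigma_\mu=\sum_{\nu\subseteq l\times k}\sum_{d\ge 0}q^d\langle\lambda,\mu,\nu^\vee\rangle_d\,\sigma_\nu,$$ where $\nu^\vee=(k-\nu_l,\ldots,k-\nu_1)$ and $\langle\lambda,\mu,\nu^\vee\rangle_d\ge 0$ is the three-point genus-zero Gromov-Witten invariant of $X$ of degree $d$. $d_{\min}$ (depending on $\lambda,\mu$) is the smallest $d$ such that $\langle\lambda,\mu,\nu^\vee\rangle_d\ne 0$ for some $\nu\subseteq l\times k$. Rim hooks: an $n$-rim hook of a Young diagram is a connected subset of $n$ of its boxes that contains no $2\times 2$ square; its width is the number of columns it occupies; it is legal if removing it leaves a valid Young diagram. $\mathrm{core}_n(\rho)$ is the partition obtained from $\rho$ by repeatedly removing legal $n$-rim hooks until no further removal is possible (it is well defined). $r_n(\rho)=(|\rho|-|\mathrm{core}_n(\rho)|)/n$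 is the number of $n$-rim hooks removed, and $\epsilon(\rho)=(-1)^{\sum_i (k-\mathrm{width}(R_i))}$, where $R_1,\ldots,R_{r_n(\rho)}$ are the removed $n$-rim hooks. The rim hook formula displayed in the claim is a known theorem of Bertram, Ciocan-Fontanine and Fulton. *)

(* Defs.v *)
From HB Require Import structures.
From mathcomp Require Import all_boot all_order all_algebra.
From mathcomp Require Import fraction reals.
From mathcomp Require Import complex mpoly.

Set Implicit Arguments.
Unset Strict Implicit.
Unset Printing Implicit Defensive.

Import GRing.Theory.
Local Open Scope ring_scope.

(** * Partitions *)

(* A partition is the weakly decreasing sequence of its positive parts. *)
Definition is_part (s : seq nat) : bool := sorted geq s && (0%N \notin s).

Definition in_rect (l k : nat) (s : seq nat) : bool :=
  [&& is_part s, (size s <= l)%N & (head 0%N s <= k)%N].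

(* Duplicate-free list of the partitions contained in the a x b rectangle
   (see [mem_shapes] and [shapes_uniq]). *)
Fixpoint shapes (a b : nat) : seq (seq nat) :=
  if a is a'.+1 then
    [::] :: [seq i :: s | i <- iota 1 b, s <- shapes a' i]
  else [:: [::]].

Lemma shapes_uniq a b : uniq (shapes a b).
Proof.
elim: a b => [//|a IH] b /=; apply/andP; split.
  by apply/negP=> /flatten_mapP[i _ /mapP[]].
apply: allpairs_uniq_dep => //; first exact: iota_uniq.
by move=> [i s] [j t] /= _ _ [-> ->].
Qed.

Lemma mem_shapes a b s : (s \in shapes a b) = in_rect a b s.
Proof.
elim: a b s => [|a IH] b [|i s] //=; first by rewrite /in_rect andbF.
rewrite inE /=; apply/flatten_mapP/idP => [[j + /mapP[t + [-> ->]]]|].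
  rewrite mem_iota IH => /andP[j0 jb] /and3P[/andP[st nt] szt ht].
  rewrite /in_rect /is_part /= inE negb_or nt ltnS szt eq_sym -lt0n j0 -ltnS jb andbT.
  by case: t st ht {nt szt} => //= x t -> ->.
case/and3P=> /andP[/= sis]; rewrite inE negb_or eq_sym -lt0n.
move=> /andP[i0 ns] szs ib; exists i.
  by rewrite mem_iota i0 ltnS.
apply/mapP; exists s => //; rewrite IH /in_rect /is_part ns (path_sorted sis) -ltnS szs /=.
by case: s sis {ns szs} => //= x s /andP[].
Qed.

Definition drop_zeros (s : seq nat) : seq nat := [seq x <- s | (0 < x)%N].

(* The dual (k - nu_l, ..., k - nu_1) of nu in the l x k rectangle. *)
Definition dual_part (l k : nat) (nu : seq nat) : seq nat :=
  drop_zeros [seq (k - nth 0%N nu (l - i.+1))%N | i <- iota 0 l].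

(** * Littlewood-Richardson coefficients *)

(* det (x_j ^ (lam_i + N - i)), 1 <= i, j <= N, for lam with at most N parts *)
Definition alternant (N : nat) (lam : seq nat) : {mpoly int[N]} :=
  \det (\matrix_(i < N, j < N)
     ('X_j : {mpoly int[N]}) ^+ (nth 0%N lam i + (N - i.+1))%N).

(* The Schur polynomial in N variables, as a quotient of alternants; it
   vanishes when lam has more than N parts. *)
Definition schur (N : nat) (lam : seq nat) : {fraction {mpoly int[N]}} :=
  if (size lam <= N)%N then tofrac (alternant N lam) / tofrac (alternant N [::])
  else 0.

(* c lam mu rho is the Littlewood-Richardson coefficient: the multiplication
   constants of Schur functions.  This determines c on partitions, the Schur
   functions being linearly independent. *)
Definition LR_coefficients (c : seq nat -> seq nat -> seq nat -> nat) : Prop :=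
  (forall lam mu rho : seq nat,
      is_part lam -> is_part mu -> is_part rho ->
      c lam mu rho <> 0%N -> sumn rho = (sumn lam + sumn mu)%N) /\
  (forall (N : nat) (lam mu : seq nat),
      is_part lam -> is_part mu ->
      let m := (sumn lam + sumn mu)%N in
      schur N lam * schur N mu =
      \sum_(rho <- shapes m m | sumn rho == m) schur N rho *+ c lam mu rho).

(** * Rim hooks and cores *)

Definition box (rho : seq nat) := ('I_(size rho) * 'I_(head 0%N rho))%type.

Definition diagram (rho : seq nat) : {set box rho} :=
  [set b : box rho | (b.2 < nth 0%N rho b.1)%N].

Section RimHooks.
Variable rho : seq nat.
Implicit Types (b : box rho) (R : {set box rho}).

Definition adjacent b b' : bool :=
  ((b.1 == b'.1) && ((b.2.+1 == b'.2 :> nat) || (b'.2.+1 == b.2 :> nat)))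
  || ((b.2 == b'.2) && ((b.1.+1 == b'.1 :> nat) || (b'.1.+1 == b.1 :> nat))).

Definition connected_boxes R : bool :=
  [forall b in R, forall b' in R,
     connect [rel u v | [&& u \in R, v \in R & adjacent u v]] b b'].

Definition has_2x2_square R : bool :=
  [exists b in R, exists b' in R,
     [&& b'.1 == b.1.+1 :> nat, b'.2 == b.2.+1 :> nat,
         (b.1, b'.2) \in R & (b'.1, b.2) \in R]].

Definition rim_hook (n : nat) R : bool :=
  [&& R \subset diagram rho, #|R| == n, connected_boxes R
    & ~~ has_2x2_square R].

Definition width R : nat := #|[set b.2 | b in R]|.

(* What remains is closed under moving up and to the left. *)
Definition legal R : bool :=
  [forall b in diagram rho :\: R, forall b' : box rho,
     (b'.1 <= b.1)%N && (b'.2 <= b.2)%N ==> (b' \in diagram rho :\: R)].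

(* The row lengths of the Young diagram left after removing a legal R. *)
Definition remove_boxes R : seq nat :=
  drop_zeros [seq #|[set j | (i, j) \in diagram rho :\: R]| | i : 'I_(size rho)].
End RimHooks.

(* Removes legal n-rim hooks for as long as there is one, at most [fuel]
   times; returns what remains and the widths of the removed hooks.  The first
   component, the number of hooks and the parity of the sum of the widths do
   not depend on the hooks chosen by [pick]. *)
Fixpoint remove_rim_hooks (fuel n : nat) (rho : seq nat) : seq nat * seq nat :=
  if fuel is fuel'.+1 then
    if [pick R : {set box rho} | rim_hook n R && legal R] is Some R then
      let res := remove_rim_hooks fuel' n (remove_boxes R) in
      (res.1, width R :: res.2)
    else (rho, [::])
  else (rho, [::]).

(* For n > 0 there are at most |rho| removals. *)
Definition core (n : nat) (rho : seq nat) : seq nat :=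
  (remove_rim_hooks (sumn rho) n rho).1.

Definition hook_widths (n : nat) (rho : seq nat) : seq nat :=
  (remove_rim_hooks (sumn rho) n rho).2.

Definition r_ (n : nat) (rho : seq nat) : nat :=
  ((sumn rho - sumn (core n rho)) %/ n)%N.

(* Used only for rho with rho_1 <= k, where all widths are at most k and the
   truncated subtraction is exact. *)
Definition hook_sign (k n : nat) (rho : seq nat) : int :=
  (-1) ^+ (\sum_(w <- hook_widths n rho) (k - w))%N.

(** * Gromov-Witten invariants of Gr(l, C^n) *)

Section GromovWitten.
Variable R : realType.
Local Notation C := R[i].

(* A morphism P^1 -> Gr(l, C^n) restricts to the affine line as
   t |-> row space of A(t), where A is an l x n matrix of polynomials with
   A(t) of rank l for every t, and it is determined by this restriction.  *)
Definition eval_at (l n : nat) (A : 'M[{poly C}]_(l, n)) (t : C) :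
    'M[C]_(l, n) :=
  \matrix_(i, j) (A i j).[t].

(* The l x l minors of such an A have no common zero and are the Pluecker
   coordinates of the morphism, so its degree is their largest degree. *)
Definition is_curve (l n d : nat) (A : 'M[{poly C}]_(l, n)) : Prop :=
  (forall t : C, \rank (eval_at A t) = l) /\
  (\max_(f : {ffun 'I_l -> 'I_n}) (size (\det (colsub f A))).-1)%N = d.

Definition same_curve (l n : nat) (A B : 'M[{poly C}]_(l, n)) : Prop :=
  forall t : C, (eval_at A t == eval_at B t)%MS.

(* The span of the first m rows of g, as a row space. *)
Definition flag_space (n : nat) (g : 'M[C]_n) (m : nat) : 'M[C]_n :=
  pid_mx m *m g.

(* The row space of V lies in the Schubert variety of codimension |lam| of the
   flag F_m = flag_space g m:
   dim (V :&: F_(k + i - lam_i)) >= i for 1 <= i <= l. *)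
Definition in_schubert_variety (l k : nat) (lam : seq nat)
    (g : 'M[C]_(l + k)) (V : 'M[C]_(l, l + k)) : Prop :=
  forall i : nat, (0 < i <= l)%N ->
    (i <= \rank (V :&: flag_space g (k + i - nth 0%N lam i.-1))%MS)%N.

(* Curves of degree d meeting three translated Schubert varieties at the fixed
   distinct points 0, 1 and -1 of P^1. *)
Definition curve_through (l k d : nat) (lam mu nu : seq nat)
    (g1 g2 g3 : 'M[C]_(l + k)) (A : 'M[{poly C}]_(l, l + k)) : Prop :=
  [/\ is_curve d A,
      in_schubert_variety lam g1 (eval_at A 0),
      in_schubert_variety mu g2 (eval_at A 1)
    & in_schubert_variety nu g3 (eval_at A (-1))].

Definition curve_count (l k d : nat) (lam mu nu : seq nat)
    (g1 g2 g3 : 'M[C]_(l + k)) (N : nat) : Prop :=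
  exists A : 'I_N -> 'M[{poly C}]_(l, l + k),
    [/\ forall i, curve_through d lam mu nu g1 g2 g3 (A i),
        forall i j, same_curve (A i) (A j) -> i = j
      & forall B, curve_through d lam mu nu g1 g2 g3 B ->
          exists i, same_curve (A i) B].

Definition entries3 (n : nat) (g1 g2 g3 : 'M[C]_n) :
    'rV[C]_(n * n + (n * n + n * n)) :=
  row_mx (mxvec g1) (row_mx (mxvec g2) (mxvec g3)).

(* N = <lam, mu, nu>_d: zero unless |lam| + |mu| + |nu| is the dimension
   l k + n d of the space of 3-pointed maps, and then the number of curves for
   (g1, g2, g3) in a nonempty Zariski open subset of GL_n^3 (here the
   complement of p = 0). *)
Definition is_GW_invariant (l k : nat) (lam mu nu : seq nat) (d N : nat) : Prop :=
  if (sumn lam + sumn mu + sumn nu == l * k + (l + k) * d)%N then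
    let n2 := ((l + k) * (l + k))%N in
    exists2 p : {mpoly C[(n2 + (n2 + n2))%N]}, p != 0 &
      forall g1 g2 g3 : 'M[C]_(l + k),
        g1 \in unitmx -> g2 \in unitmx -> g3 \in unitmx ->
        p.@[fun i => entries3 g1 g2 g3 0 i] != 0 ->
        curve_count d lam mu nu g1 g2 g3 N
  else N = 0%N.

Definition GW_invariants (l k : nat)
    (GW : seq nat -> seq nat -> seq nat -> nat -> nat) : Prop :=
  forall (lam mu nu : seq nat) (d : nat),
    in_rect l k lam -> in_rect l k mu -> in_rect l k nu ->
    is_GW_invariant l k lam mu nu d (GW lam mu nu d).
End GromovWitten.

(** * Quantum cohomology and the rim hook formula *)

(* The free Z[q]-module on the partitions contained in l x k; q is 'X. *)
Definition QH (l k : nat) := {ffun seq_sub (shapes l k) -> {poly int}^o}.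

Definition sigma (l k : nat) (nu : seq nat) : QH l k :=
  [ffun x => (val x == nu)%:R].

Section Statement.
Variables (l k : nat) (lam mu : seq nat).
Variable c : seq nat -> seq nat -> seq nat -> nat.
Variable GW : seq nat -> seq nat -> seq nat -> nat -> nat.

(* sigma_lam * sigma_mu; the invariants of degree d > |lam| + |mu| vanish for
   dimension reasons. *)
Definition quantum_product : QH l k :=
  \sum_(nu <- shapes l k) \sum_(d < (sumn lam + sumn mu).+1)
    ('X^d *+ GW lam mu (dual_part l k nu) d : {poly int}) *: sigma l k nu.

Definition in_P (rho : seq nat) : bool :=
  [&& is_part rho, (head 0%N rho <= k)%N, c lam mu rho != 0%N
    & in_rect l k (core (l + k) rho)].

(* All elements of P occur in this list, since |rho| = |lam| + |mu| on P. *)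
Definition candidates : seq (seq nat) := shapes (sumn lam + sumn mu) k.

Definition signed_coeff (rho : seq nat) : {poly int} :=
  (hook_sign k (l + k) rho * (c lam mu rho)%:Z)%:P.

Definition rim_hook_formula : Prop :=
  quantum_product =
  \sum_(rho <- candidates | in_P rho)
    ('X^(r_ (l + k) rho) * signed_coeff rho) *: sigma l k (core (l + k) rho).

Definition is_r0 (r0 : nat) : Prop :=
  (exists2 rho, in_P rho & r_ (l + k) rho = r0) /\
  (forall rho, in_P rho -> (r0 <= r_ (l + k) rho)%N).

Definition lowest_contribution (r0 : nat) : QH l k :=
  \sum_(rho <- candidates | in_P rho && (r_ (l + k) rho == r0))
    signed_coeff rho *: sigma l k (core (l + k) rho).

Definition is_dmin (d0 : nat) : Prop :=
  (exists2 nu, in_rect l k nu & GW lam mu (dual_part l k nu) d0 <> 0%N) /\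
  (forall d nu, in_rect l k nu -> GW lam mu (dual_part l k nu) d <> 0%N ->
     (d0 <= d)%N).
End Statement.

(* Main.v *)
Require Import Defs.
From mathcomp Require Import all_boot all_order all_algebra reals.
From mathcomp Require Import all_fingroup fraction mpoly algC cyclotomic zify.

(* Transposing partitions and recording [rho] by the beads
   [rho'_m + k - 1 - m], [m < k], turns Schur functions into alternants in [k]
   variables, and removing an [n]-rim hook of width [w] into lowering one bead
   by [n] past [w - 1] others.  Hence at [n]-th roots of unity the product of
   two alternants obeys the rim hook formula at [q = (-1)^(k-1)]; no power of
   [q] is lost, since it is determined by the size of the Schubert class.
   Rotating the beads of [lam] by [t] and those of [mu] by [-t] changes this
   product only by a sign.

   Let [f t] be the number of beads of [lam] that are at least [n - t], plus
   the number of beads of [mu] that are at least [t], minus [k], and let [D] be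
   the maximum of [f].  For an optimal [t] the rotated pair fits in the
   rectangle like a partition and a subpartition of its dual, so its product
   has a term without rim hooks, which cannot cancel; it gives a nonzero
   coefficient of degree [D] in the original product.  Conversely, Horn-type
   inequalities for Littlewood-Richardson coefficients show that every [rho]
   of [P] has at least [D] beads that are at least [n], so that at least [D]
   rim hooks must be removed from it. *)

Set Implicit Arguments.
Unset Strict Implicit.
Unset Printing Implicit Defensive.

Local Notation "s `_ i" := (nth 0%N s i) : nat_scope.

(** * Partitions *)

(** The obstacle is that [hook_sign] varies among the [rho] of one degree, so nonnegativity of
    Littlewood-Richardson coefficients does not exclude cancellation. Rotation moves the question to
    a pair whose relevant coefficient is one Littlewood-Richardson coefficient, without a sign. It
    is the cyclic symmetry of the quantum ring of the Grassmannian, and elementary for alternants: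
    at [n]-th roots of unity exponents matter modulo [n] only, and adding [t] to all of them
    multiplies the alternant by the [t]-th power of the product of the variables. The shifts [t] and
    [n - t] together give the [n]-th power, which is 1. Transposition fits the shape of [P]: its
    members may have more than [l] rows but at most [k] columns, and [k] variables retain exactly
    the transposes of such [rho]. [LR_coefficients] describes [c] as structure constants of Schur
    polynomials, so its properties come from the Pieri rules: associativity gives a recursion along
    strips, and since [c] is nonnegative, nonvanishing propagates along them. This yields the
    inequalities, and also the nonvanishing product inside a rectangle. Values at roots of unity
    determine the coefficients by Fourier inversion. *)

Definition colen (s : seq nat) (j : nat) : nat := count (fun x => j < x) s.

Definition conjp (s : seq nat) : seq nat := [seq colen s j | j <- iota 0 (head 0 s)].

Definition mkpart (N : nat) (g : nat -> nat) : seq nat :=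
  drop_zeros [seq g i | i <- iota 0 N].

Definition partitions_of (m : nat) : seq (seq nat) :=
  [seq s <- shapes m m | sumn s == m].

Lemma part_geS s i : is_part s -> s`_i.+1 <= s`_i.
Proof.
case/andP=> so _; have [lt|ge] := ltnP i.+1 (size s); last by rewrite nth_default.
by have := (sortedP 0 so) i lt.
Qed.

Lemma part_ge s i j : is_part s -> i <= j -> s`_j <= s`_i.
Proof.
move=> ps /subnK <-; elim: (j - i) => // d IH.
by rewrite addSn (leq_trans (part_geS _ ps)).
Qed.

Lemma part_nth_gt0 s i : is_part s -> (0 < s`_i) = (i < size s).
Proof.
case/andP=> _ z; have [lt|ge] := ltnP i (size s); last by rewrite nth_default.
by rewrite lt0n; apply: contraNneq z => <-; apply: mem_nth.
Qed.

Lemma part_ext s t : is_part s -> is_part t -> (forall i, s`_i = t`_i) -> s = t.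
Proof.
move=> ps pt e; have es : size s = size t.
  apply/eqP; rewrite eqn_leq; apply/andP; split; rewrite leqNgt.
    by rewrite -part_nth_gt0 // e part_nth_gt0 // ltnn.
  by rewrite -part_nth_gt0 // -e part_nth_gt0 // ltnn.
by apply: (@eq_from_nth _ 0) => // i _.
Qed.

Lemma is_partP s : (forall i, s`_i.+1 <= s`_i) -> (forall i, i < size s -> 0 < s`_i) ->
  is_part s.
Proof.
move=> h1 h2; apply/andP; split; first by apply/(sortedP 0) => i _; apply: h1.
by apply/(nthP 0) => -[i lt e]; have := h2 i lt; rewrite e.
Qed.

Lemma head_nth0 (s : seq nat) : head 0 s = s`_0.
Proof. by case: s. Qed.

Lemma sumn_nth (s : seq nat) N : size s <= N -> sumn s = \sum_(i < N) s`_i.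
Proof.
move=> le; rewrite sumnE (big_nth 0) big_mkord.
rewrite (big_ord_widen _ (fun i => s`_i) le) [RHS](bigID (fun i : 'I_N => i < size s)) /=.
by rewrite [X in _ = _ + X]big1 ?addn0 // => i; rewrite -leqNgt => h; rewrite nth_default.
Qed.

Lemma mkpartP N g : (forall i, g i.+1 <= g i) -> g N = 0 ->
  [/\ is_part (mkpart N g), forall i, (mkpart N g)`_i = g i & size (mkpart N g) <= N].
Proof.
move=> dec z.
have gz i : g i = 0 -> forall j, i <= j -> g j = 0.
  move=> e j /subnK <-; elim: (j - i) => // d IH; rewrite addSn.
  by apply/eqP; rewrite -leqn0 -IH.
have E : exists2 M, M <= N & mkpart N g = [seq g i | i <- iota 0 M] /\
    (forall i, (i < M) = (0 < g i)).
  pose M := find (fun i => g i == 0) (iota 0 N.+1).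
  have has0 : has (fun i => g i == 0) (iota 0 N.+1).
    by apply/hasP; exists N; rewrite ?mem_iota ?z //= leqnn.
  have ltM : M < N.+1 by move: has0; rewrite has_find size_iota.
  have gM : g M = 0 by have := nth_find 0 has0; rewrite nth_iota // add0n => /eqP.
  have lM i : i < M -> 0 < g i.
    move=> lt; have := before_find 0 lt; rewrite nth_iota ?add0n; last exact: ltn_trans ltM.
    by rewrite lt0n => ->.
  exists M => //; split; last first.
    move=> i; apply/idP/idP; first exact: lM.
    by apply: contraTT; rewrite -!leqNgt leqn0 => /(gz _ gM)->.
  rewrite /mkpart /drop_zeros -(subnKC (ltM : M <= N)) iotaD map_cat filter_cat.
  rewrite (_ : [seq x <- [seq g i | i <- iota 0 M] | 0 < x] = [seq g i | i <- iota 0 M]).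
    rewrite (_ : [seq x <- _ | _ ] = [::]) ?cats0 //.
    apply/eqP; rewrite -(negbK (_ == _)) -has_filter; apply/hasPn=> x /mapP[i].
    by rewrite mem_iota add0n => /andP[le _] ->; rewrite (gz _ gM _ le).
  by apply/all_filterP/allP=> x /mapP[i]; rewrite mem_iota => /andP[_ /lM h] ->.
case: E => M leM [-> gt].
have nthE i : [seq g i0 | i0 <- iota 0 M]`_i = g i.
  have [lt|ge] := ltnP i M; first by rewrite (nth_map 0) ?size_iota // nth_iota.
  by rewrite nth_default ?size_map ?size_iota //; move: ge; rewrite leqNgt gt -eqn0Ngt => /eqP.
split=> //; last by rewrite size_map size_iota.
apply: is_partP => i; first by rewrite !nthE.
by rewrite size_map size_iota nthE gt.
Qed.

Lemma sumn_mkpart N g : sumn (mkpart N g) = \sum_(i < N) g i.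
Proof.
rewrite /mkpart -(big_mkord xpredT g) /index_iota subn0 -(big_map g xpredT id) /=.
elim: [seq g i | i <- iota 0 N] => [|x s IH]; first by rewrite big_nil.
by rewrite big_cons -IH /drop_zeros /=; case: x.
Qed.

(** Both sides say that the box in row [i] and column [j] lies in the diagram. Facts about
    transposes reduce to this exchange of rows and columns. *)
Lemma colen_gt s i j : is_part s -> (i < colen s j) = (j < s`_i).
Proof.
rewrite /colen; elim: s i => [|x s IH] [|i] //= /andP[so z].
- move: z; rewrite inE => /norP[_ z].
  have [//|ge] := ltnP j x.
  rewrite add0n -has_count; apply/negP=> /hasP[y yin lt].
  have /allP/(_ y yin) := order_path_min (rev_trans leq_trans) so.
  by rewrite /= leqNgt (leq_ltn_trans ge lt).
have ps : is_part s.
  by move: z; rewrite /is_part inE (path_sorted so) => /norP[_ ->].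
have [lt|ge] := ltnP j x; first by rewrite add1n ltnS IH.
rewrite add0n IH //.
have pxs : is_part (x :: s) by apply/andP.
have /= le := part_ge pxs (leq0n i.+1).
by rewrite !ltnNge (leq_trans le ge) (leq_trans (leq_trans (part_geS _ ps) le) ge).
Qed.

Lemma colen_geS s j : colen s j.+1 <= colen s j.
Proof. by apply: sub_count => x /= h; apply: ltnW. Qed.

Lemma colen_ge s i j : i <= j -> colen s j <= colen s i.
Proof. by move=> le; apply: sub_count => x /=; apply: leq_ltn_trans. Qed.

Lemma colen_head s j : is_part s -> (0 < colen s j) = (j < head 0 s).
Proof. by move=> ps; rewrite colen_gt // head_nth0. Qed.

Lemma conjp_mkpart s N : is_part s -> head 0 s <= N -> conjp s = mkpart N (colen s).
Proof.
move=> ps le; rewrite /conjp /mkpart /drop_zeros -(subnKC le) iotaD map_cat filter_cat.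
rewrite [X in _ = X ++ _](_ : _ = [seq colen s j | j <- iota 0 (head 0 s)]).
  rewrite (_ : [seq x <- _ | _ ] = [::]) ?cats0 //.
  apply/eqP; rewrite -(negbK (_ == _)) -has_filter; apply/hasPn=> x /mapP[i].
  by rewrite mem_iota add0n => /andP[h _] ->; rewrite colen_head // -leqNgt.
by apply/all_filterP/allP=> x /mapP[i]; rewrite mem_iota => /andP[_ h] ->; rewrite colen_head.
Qed.

Lemma colen_out s j : is_part s -> head 0 s <= j -> colen s j = 0.
Proof. by move=> ps le; apply/eqP; rewrite -leqn0 leqNgt colen_head // -leqNgt. Qed.

Lemma nth_conjp s j : is_part s -> (conjp s)`_j = colen s j.
Proof.
move=> ps; rewrite (conjp_mkpart ps (leqnn _)).
by have [_ -> _] := mkpartP (colen_geS s) (colen_out ps (leqnn _)).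
Qed.

Lemma conjp_part s : is_part s -> is_part (conjp s).
Proof.
move=> ps; rewrite (conjp_mkpart ps (leqnn _)).
by have [-> _ _] := mkpartP (colen_geS s) (colen_out ps (leqnn _)).
Qed.

Lemma conjp_gt s i j : is_part s -> (i < (conjp s)`_j) = (j < s`_i).
Proof. by move=> ps; rewrite nth_conjp // colen_gt. Qed.

Lemma size_conjp s : size (conjp s) = head 0 s.
Proof. by rewrite size_map size_iota. Qed.

Lemma conjpK s : is_part s -> conjp (conjp s) = s.
Proof.
move=> ps; have pc := conjp_part ps; apply: part_ext => //; first exact: conjp_part.
move=> i; apply/eqP; rewrite eqn_leq; apply/andP; split; rewrite leqNgt.
  by rewrite conjp_gt // conjp_gt // ltnn.
by rewrite -conjp_gt // -conjp_gt // ltnn.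
Qed.

Lemma head_conjp s : is_part s -> head 0 (conjp s) = size s.
Proof. by move=> ps; rewrite -size_conjp conjpK. Qed.

Lemma sumn_colen s N : is_part s -> head 0 s <= N -> sumn s = \sum_(j < N) colen s j.
Proof.
move=> ps le; rewrite sumnE.
have H x : x \in s -> x = \sum_(j < N) (j < x).
  move=> xs; have xN : x <= N.
    apply: leq_trans le; rewrite head_nth0; case/(nthP 0): xs => i _ <-.
    exact: part_ge.
  rewrite -big_mkcond /= (eq_bigr (fun i => (fun=> 1) (val i))) // -(big_ord_widen _ (fun=> 1) xN).
  by rewrite sum_nat_const card_ord muln1.
transitivity (\sum_(x <- s) \sum_(j < N) (j < x)); first exact: eq_big_seq.
rewrite exchange_big /=.
by apply: eq_bigr => j _; rewrite /colen -sum1_count [RHS]big_mkcond; apply: eq_bigr => x _; case: ifP.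
Qed.

Lemma sumn_conjp s : is_part s -> sumn (conjp s) = sumn s.
Proof. by move=> ps; rewrite (conjp_mkpart ps (leqnn _)) sumn_mkpart (sumn_colen ps (leqnn _)). Qed.

(** The [m] by [m] square loses nothing: the number of rows and the largest part are both at most
    the size. *)
Lemma mem_partitions m s : (s \in partitions_of m) = is_part s && (sumn s == m).
Proof.
rewrite mem_filter mem_shapes andbC /in_rect; case ps: (is_part s) => //=.
apply: andb_idl => /eqP <-.
have H t : head 0 t <= sumn t by case: t => //= x t; apply: leq_addr.
by rewrite -head_conjp // H -(sumn_conjp ps) H.
Qed.

Lemma partitions_uniq m : uniq (partitions_of m).
Proof. exact/filter_uniq/shapes_uniq. Qed.

Lemma size_le_sumn s : is_part s -> size s <= sumn s.
Proof.
move=> ps; have : s \in partitions_of (sumn s) by rewrite mem_partitions ps eqxx.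
by rewrite mem_filter mem_shapes => /andP[_ /and3P[]].
Qed.

Lemma perm_partitions_conjp m : perm_eq [seq conjp s | s <- partitions_of m] (partitions_of m).
Proof.
apply: uniq_perm.
- rewrite map_inj_in_uniq ?partitions_uniq // => s t.
  rewrite !mem_partitions => /andP[ps _] /andP[pt _] e.
  by rewrite -(conjpK ps) e conjpK.
- exact: partitions_uniq.
move=> s; apply/mapP/idP => [[t + ->]|].
  by rewrite !mem_partitions => /andP[pt /eqP <-]; rewrite conjp_part // sumn_conjp /=.
rewrite mem_partitions => /andP[ps /eqP e]; exists (conjp s); last by rewrite conjpK.
by rewrite mem_partitions conjp_part // sumn_conjp // e /=.
Qed.

(** * Alternants *)

Section Alternants.
Import GRing.Theory.
Local Open Scope ring_scope.

(** Values and exponents are arbitrary because roots of unity will be substituted, and Pieri rules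
    and rim hooks produce exponents that are not decreasing. *)
Definition alt (R : comNzRingType) (N : nat) (y : 'I_N -> R) (b : 'I_N -> nat) : R :=
  \det (\matrix_(i, j) y j ^+ b i).

Section Generic.
Variables (R : comNzRingType) (N : nat).
Implicit Types (y : 'I_N -> R) (b : 'I_N -> nat).

Lemma altE y b :
  alt y b = \sum_(s : 'S_N) (-1) ^+ s * \prod_i y (s i) ^+ b i.
Proof. by apply: eq_bigr => s _; congr (_ * _); apply: eq_bigr => i _; rewrite mxE. Qed.

Lemma eq_alt y y' b b' : y =1 y' -> b =1 b' -> alt y b = alt y' b'.
Proof. by move=> ey eb; congr (\det _); apply/matrixP => i j; rewrite !mxE ey eb. Qed.

Lemma alt_eq0 y b i j : i != j -> b i = b j -> alt y b = 0.
Proof. by move=> ne e; apply: (determinant_alternate ne) => m; rewrite !mxE e. Qed.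

Lemma alt_eq0y y b i j : i != j -> y i = y j -> alt y b = 0.
Proof.
by move=> ne e; rewrite /alt -det_tr; apply: (determinant_alternate ne) => m; rewrite !mxE e.
Qed.

Lemma alt_perm y b (s : 'S_N) : alt y (b \o s) = (-1) ^+ s * alt y b.
Proof.
rewrite /alt; have -> : \matrix_(i, j) y j ^+ (b \o s) i = perm_mx s *m \matrix_(i, j) y j ^+ b i.
  by rewrite -row_permE; apply/matrixP=> i j; rewrite !mxE.
by rewrite det_mulmx det_perm.
Qed.

(* For [M = 2] the elementary, for [M > r] the complete homogeneous symmetric
   polynomial of degree [r]. *)
Definition bounded_hsym (M r : nat) y : R :=
  \sum_(c : {ffun 'I_N -> 'I_M} | (\sum_i c i)%N == r) \prod_j y j ^+ c j.

(** The symmetric factor may have its variables permuted by the same [s] as each term of the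
    determinant; its exponents then add to those of the alternant row by row. *)
Lemma bounded_hsym_alt M r y b :
  bounded_hsym M r y * alt y b =
  \sum_(c : {ffun 'I_N -> 'I_M} | (\sum_i c i)%N == r) alt y (fun i => (b i + c i)%N).
Proof.
under [RHS]eq_bigr => c _ do rewrite altE.
rewrite altE mulr_sumr [RHS]exchange_big; apply: eq_bigr => s _ /=.
rewrite /bounded_hsym mulr_suml.
rewrite (reindex_onto (fun c : {ffun 'I_N -> 'I_M} => [ffun i => c (s^-1 i)%g]) (fun c => [ffun i => c (s i)])) /=; last first.
  by move=> c _; apply/ffunP=> i; rewrite !ffunE permKV.
apply: eq_big => [c|c _].
  rewrite (_ : [ffun _ => _] == c); last first.
    by apply/eqP/ffunP=> i; rewrite !ffunE permK.
  rewrite andbT (reindex_inj (@perm_inj _ s)) /=; congr (_ == _).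
  by apply: eq_bigr => i _; rewrite ffunE permK.
rewrite mulrCA; congr (_ * _); rewrite (reindex_inj (@perm_inj _ s)) /= -big_split /=.
by apply: eq_bigr => i _; rewrite ffunE permK addnC exprD.
Qed.

End Generic.

Lemma alt_rmorph (R S : comNzRingType) (f : {rmorphism R -> S}) N (y : 'I_N -> R) b :
  f (alt y b) = alt (f \o y) b.
Proof.
rewrite -det_map_mx; congr (\det _); apply/matrixP=> i j.
by rewrite !mxE rmorphXn.
Qed.

Definition mvar N : 'I_N -> {mpoly int[N]} := fun j => 'X_j.

Definition sdecr N (b : 'I_N -> nat) : Prop := forall i j : 'I_N, (i < j)%N -> (b j < b i)%N.

(** Such an [s] is increasing, so [s i >= i] for all [i]; both sides have the same sum, so equality
    holds throughout. *)
Lemma sdecr_perm N (b b' : 'I_N -> nat) (s : 'S_N) :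
  sdecr b -> sdecr b' -> (forall i, b' (s i) = b i) -> s = 1%g.
Proof.
move=> db db' e.
have mono (i j : 'I_N) : (i < j)%N -> (s i < s j)%N.
  move=> lt; rewrite ltnNge; apply/negP; rewrite leq_eqVlt => /orP[/eqP/val_inj/perm_inj E|/db'].
    by rewrite E ltnn in lt.
  by rewrite !e ltnNge ltnW // db.
have ge m (i : 'I_N) : (i = m :> nat) -> (m <= s i)%N.
  elim: m i => // m IH i e'; have mN : (m < N)%N by rewrite ltnW // -e'.
  have := mono (Ordinal mN) i; rewrite /= e' ltnSn => /(_ isT); apply: leq_ltn_trans.
  exact: IH.
have: (\sum_(i < N) s i = \sum_(i < N) i)%N.
  by rewrite [RHS](reindex_inj (@perm_inj _ s)).
have [_] := leqif_sum (fun (i : 'I_N) (_ : true) => leqif_eq (ge i i erefl)).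
move=> + E; rewrite E eqxx => /esym/forallP h; apply/permP=> i; rewrite perm1.
by apply/val_inj/esym/eqP/h.
Qed.

(** Among the monomials of an alternant only that of the identity permutation has decreasing
    exponents. Hence these alternants are linearly independent. *)
Lemma alt_coeff N (b b' : 'I_N -> nat) : sdecr b -> sdecr b' ->
  (alt (@mvar N) b)@_[multinom b' i | i < N] = [forall i, b i == b' i]%:R.
Proof.
move=> db db'; rewrite altE raddf_sum /=.
have E (s : 'S_N) : ((-1) ^+ s * \prod_i @mvar N (s i) ^+ b i)@_[multinom b' i | i < N]
    = (-1) ^+ s * [forall i, b i == b' (s i)]%:R.
  have -> : \prod_i @mvar N (s i) ^+ b i = 'X_[ [multinom b (s^-1 i)%g | i < N] ].
    by rewrite (mpolyXE _ s); apply: eq_bigr => i _; rewrite mnmE permK.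
  have -> : [forall i, b i == b' (s i)] =
      ([multinom b (s^-1 i)%g | i < N] == [multinom b' i | i < N] :> 'X_{1..N}).
    apply/forallP/eqP => [h|h i].
      by apply/mnmP=> i; rewrite !mnmE; have := h (s^-1 i)%g; rewrite permKV => /eqP.
    by have /mnmP/(_ (s i)) := h; rewrite !mnmE permK => ->.
  by case: (odd_perm s); rewrite ?expr1 ?expr0 ?mulN1r ?mul1r ?mcoeffN mcoeffX.
rewrite (eq_bigr _ (fun s _ => E s)) (bigD1 1%g) //= odd_perm1 expr0 mul1r.
rewrite big1 ?addr0; last first.
  move=> s; case: forallP => [h ne|_ _]; last by rewrite mulr0.
  by rewrite (sdecr_perm db db' (s := s)) ?eqxx // in ne; move=> i; rewrite (eqP (h i)).
by congr (nat_of_bool _)%:R; apply: eq_forallb => i; rewrite perm1.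
Qed.

End Alternants.

(** * Pieri rules *)

Definition vstrip (s t : seq nat) : bool :=
  all (fun i => s`_i <= t`_i <= (s`_i).+1) (iota 0 (maxn (size s) (size t))).

Definition hstrip (s t : seq nat) : bool :=
  all (fun i => (s`_i <= t`_i) && (t`_i.+1 <= s`_i)) (iota 0 (maxn (size s) (size t))).

Lemma vstripP s t : reflect (forall i, s`_i <= t`_i <= (s`_i).+1) (vstrip s t).
Proof.
apply: (iffP allP) => [h i|h i _ //].
have [lt|] := ltnP i (maxn (size s) (size t)); first by apply: h; rewrite mem_iota.
by rewrite geq_max => /andP[h1 h2]; rewrite !nth_default.
Qed.

Lemma hstripP s t : reflect (forall i, s`_i <= t`_i /\ t`_i.+1 <= s`_i) (hstrip s t).
Proof.
apply: (iffP allP) => [h i|h i _]; last exact/andP.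
have [lt|] := ltnP i (maxn (size s) (size t)); first by apply/andP/h; rewrite mem_iota.
by rewrite geq_max => /andP[h1 h2]; rewrite !nth_default // ltnW.
Qed.

Lemma vstrip_conjp s t : is_part s -> is_part t -> vstrip (conjp s) (conjp t) = hstrip s t.
Proof.
move=> ps pt; apply/vstripP/hstripP => h i.
  split; rewrite leqNgt; apply/negP.
    rewrite -conjp_gt // => lt; have := h t`_i; rewrite leqNgt => /andP[/negP[]].
    by rewrite (leq_trans _ lt) // ltnS leqNgt conjp_gt // ltnn.
  rewrite -conjp_gt // => lt; have := h s`_i; rewrite andbC leqNgt => /andP[/negP[]].
  by rewrite (leq_trans _ lt) // !ltnS leqNgt conjp_gt // ltnn.
apply/andP; split; rewrite leqNgt; apply/negP.
  rewrite conjp_gt // => lt; have [] := h (conjp t)`_i; rewrite leqNgt => /negP[].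
  by rewrite (leq_trans _ lt) // ltnS leqNgt -conjp_gt // ltnn.
rewrite conjp_gt // => lt; have [_] := h (conjp s)`_i; rewrite leqNgt => /negP[].
by rewrite (leq_trans _ lt) // ltnS leqNgt -conjp_gt // ltnn.
Qed.

Lemma hstrip_conjp s t : is_part s -> is_part t -> hstrip (conjp s) (conjp t) = vstrip s t.
Proof. by move=> ps pt; rewrite -vstrip_conjp ?conjp_part // !conjpK. Qed.

Section Pieri.
Import GRing.Theory.
Local Open Scope ring_scope.

(** The sum equals its own negative. Fixed points of [f] are allowed, which is why the absence of
    2-torsion is assumed. *)
Lemma sum_antiinvol (V : zmodType) (I : finType) (P : pred I) (F : I -> V) (f : I -> I) :
  (forall v : V, v *+ 2 = 0 -> v = 0) ->
  (forall i, P i -> [/\ P (f i), f (f i) = i & F (f i) = - F i]) ->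
  \sum_(i | P i) F i = 0.
Proof.
move=> tf h; apply: tf; rewrite mulr2n {1}(reindex_onto f f) => [|i /h[] //].
rewrite (eq_big P (fun i => - F i)) ?sumrN ?addNr // => [i|i /andP[/h[Pi _ _] /eqP e]].
  apply/andP/idP => [[/h[Pi _ _] /eqP e]|Pi]; first by rewrite e in Pi.
  by have [-> -> _] := h i Pi; rewrite eqxx.
by rewrite e in Pi; case: (h i Pi).
Qed.

(** All Schur polynomials in [N] variables share one denominator, so linear relations among them can
    be treated in the polynomial ring. *)
Definition schur_num N (s : seq nat) : {mpoly int[N]} :=
  if (size s <= N)%N then alternant N s else 0.

Lemma schur_numE N s : (size s <= N)%N ->
  schur_num N s = alt (@mvar N) (fun i => s`_i + (N - i.+1))%N.
Proof. by rewrite /schur_num => ->. Qed.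

(** Bookkeeping common to both Pieri rules: once the cancelling terms are gone, the increments [c]
    satisfying [R] are the differences [t - s] for the strips from [s] to [t]. *)
Lemma strip_sum (V : nmodType) (strip : rel (seq nat)) (N M r : nat) (s : seq nat)
    (R : pred {ffun 'I_N -> 'I_M.+1}) (F : ('I_N -> nat) -> V) :
    is_part s -> (size s <= N)%N ->
    (forall f g, f =1 g -> F f = F g) ->
    (forall t, is_part t -> (size t <= N)%N -> strip s t -> sumn t = (sumn s + r)%N ->
       exists2 c : {ffun 'I_N -> 'I_M.+1}, R c & forall i : 'I_N, t`_i = (s`_i + c i)%N) ->
    (forall c : {ffun 'I_N -> 'I_M.+1}, R c -> (\sum_i c i)%N = r ->
       exists t, [/\ is_part t, (size t <= N)%N, strip s t
                   & forall i : 'I_N, t`_i = (s`_i + c i)%N]) ->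
  \sum_(c : {ffun 'I_N -> 'I_M.+1} | ((\sum_i c i)%N == r) && R c)
     F (fun i => s`_i + c i)%N =
  \sum_(t <- partitions_of (sumn s + r) | (size t <= N)%N && strip s t)
     F (fun i => t`_i).
Proof.
move=> ps les Fext h1 h2.
pose g (t : seq nat) : {ffun 'I_N -> 'I_M.+1} := [ffun i : 'I_N => inord (t`_i - s`_i)].
have gE t (c : {ffun 'I_N -> 'I_M.+1}) : (forall i : 'I_N, t`_i = (s`_i + c i)%N) -> g t = c.
  by move=> e; apply/ffunP => i; rewrite ffunE e addKn inord_val.
have sums t (c : {ffun 'I_N -> 'I_M.+1}) : (size t <= N)%N ->
    (forall i : 'I_N, t`_i = (s`_i + c i)%N) -> sumn t = (sumn s + \sum_i c i)%N.
  move=> st e; rewrite (sumn_nth st) (sumn_nth les) -big_split.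
  by apply: eq_bigr => i _ /=.
rewrite -[RHS]big_filter.
set T := [seq t <- _ | _].
have TE t : (t \in T) =
    ((size t <= N)%N && strip s t) && (is_part t && (sumn t == (sumn s + r)%N)).
  by rewrite mem_filter mem_partitions.
transitivity (\sum_(c <- [seq g t | t <- T]) F (fun i : 'I_N => s`_i + c i)%N).
  rewrite -big_filter; apply: perm_big; apply: uniq_perm.
  - by rewrite filter_uniq // index_enum_uniq.
  - rewrite map_inj_in_uniq; first exact/filter_uniq/partitions_uniq.
    move=> t t'.
    rewrite !TE => /andP[/andP[st str] /andP[pt /eqP et]].
    move=> /andP[/andP[st' str'] /andP[pt' /eqP et']].
    have [c _ ec] := h1 t pt st str et; have [c' _ ec'] := h1 t' pt' st' str' et'.
    rewrite (gE _ _ ec) (gE _ _ ec') => e; rewrite -e in ec'.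
    apply: part_ext => // i; have [lt|ge] := ltnP i N.
      by rewrite (ec (Ordinal lt)) (ec' (Ordinal lt)).
    by rewrite !nth_default // (leq_trans _ ge).
  move=> c; rewrite mem_filter mem_index_enum andbT; apply/andP/mapP => [[/eqP e Rc]|[t]].
    have [t [pt st str et]] := h2 c Rc e; exists t; last by rewrite (gE _ _ et).
    by rewrite TE st str pt (sums _ _ st et) e /=.
  rewrite TE => /andP[/andP[st str] /andP[pt /eqP et]].
  have [c' Rc ec] := h1 t pt st str et; rewrite (gE _ _ ec) => ->; split=> //.
  by have /eqP := sums _ _ st ec; rewrite et eqn_add2l eq_sym.
rewrite big_map; apply: eq_big_seq => t.
rewrite TE => /andP[/andP[st str] /andP[pt /eqP et]].
have [c _ ec] := h1 t pt st str et; apply: Fext => i; by rewrite (gE _ _ ec) ec.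
Qed.

Lemma fun_part N (p : 'I_N -> nat) :
  (forall i j : 'I_N, i.+1 = j -> (p j <= p i)%N) ->
  exists t, [/\ is_part t, (size t <= N)%N & forall i : 'I_N, t`_i = p i].
Proof.
move=> dec; pose g i := if insub i is Some i' then p i' else 0%N.
have gE (i : 'I_N) : g i = p i by rewrite /g valK.
have g0 i : (N <= i)%N -> g i = 0%N by move=> le; rewrite /g insubN // -leqNgt.
have gS i : (g i.+1 <= g i)%N.
  have [lt|ge] := ltnP i.+1 N; last by rewrite g0.
  by rewrite (gE (Ordinal lt)) (gE (Ordinal (ltnW lt))); apply: dec.
have [pt nt st] := mkpartP gS (g0 N (leqnn N)).
by exists (mkpart N g); split=> // i; rewrite nt gE.
Qed.

Lemma schur_num_strip N r (strip : rel (seq nat)) s : (size s <= N)%N ->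
  \sum_(t <- partitions_of (sumn s + r) | strip s t) schur_num N t =
  \sum_(t <- partitions_of (sumn s + r) | (size t <= N)%N && strip s t)
     alt (@mvar N) (fun i => t`_i + (N - i.+1))%N.
Proof.
move=> les; rewrite (bigID (fun t : seq nat => size t <= N)%N) /=.
rewrite [X in _ + X]big1 ?addr0 => [|t /andP[_ /negbTE h]]; last by rewrite /schur_num h.
by apply: eq_big => [t|t /andP[_ h]]; [rewrite andbC | rewrite schur_numE].
Qed.

Lemma pieri_v N r s : is_part s ->
  bounded_hsym 2 r (@mvar N) * schur_num N s =
  \sum_(t <- partitions_of (sumn s + r) | vstrip s t) schur_num N t.
Proof.
move=> ps; have [les|gts] := leqP (size s) N; last first.
  rewrite /schur_num leqNgt gts mulr0 big_seq_cond big1 // => t.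
  rewrite mem_partitions => /andP[/andP[pt _] /vstripP h].
  have lt0 : (0 < s`_N)%N by rewrite part_nth_gt0.
  by rewrite leqNgt -part_nth_gt0 // (leq_trans lt0) //; case/andP: (h N).
rewrite (schur_num_strip _ _ les) schur_numE // bounded_hsym_alt.
pose R (c : {ffun 'I_N -> 'I_2}) := [forall i : 'I_N, forall j : 'I_N,
  (i.+1 == j) ==> (s`_j + c j <= s`_i + c i)%N].
(* As increments are 0 or 1, [R] can fail only if rows [i] and [i + 1] of [s] are equal and only the
   lower one grows. Their two exponents then coincide and the alternant vanishes. *)
rewrite (bigID R) /= [X in _ + X]big1 ?addr0; last first.
  move=> c /andP[_ /forallPn[i /forallPn[j]]]; rewrite negb_imply -ltnNge => /andP[/eqP e lt].
  apply: (@alt_eq0 _ _ _ _ i j); first by rewrite -val_eqE /= -e; lia.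
  have := part_geS i ps; have := ltn_ord (c i); have := ltn_ord (c j); have := ltn_ord j.
  by rewrite e; lia.
apply: etrans (@strip_sum _ vstrip N 1 r s R
  (fun f => alt (@mvar N) (fun i => f i + (N - i.+1))%N) ps les _ _ _).
- by apply: eq_bigr => c _; apply: eq_alt => // i; rewrite addnAC.
- by move=> f g e; apply: eq_alt => // i; rewrite e.
- move=> t pt st /vstripP h _.
  have E (i : 'I_N) : t`_i = (s`_i + (inord (t`_i - s`_i) : 'I_2))%N.
    by have /andP[h1 h2] := h i; rewrite inordK ?subnKC // ltnS leq_subLR addn1.
  exists [ffun i : 'I_N => inord (t`_i - s`_i)]; last by move=> i; rewrite ffunE.
  by apply/forallP=> i; apply/forallP=> j; apply/implyP=> /eqP e; rewrite !ffunE -!E -e part_geS.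
move=> c /forallP Rc _; have [t [pt st et]] : exists t, [/\ is_part t, (size t <= N)%N &
    forall i : 'I_N, t`_i = (s`_i + c i)%N].
  apply: (@fun_part _ (fun i => s`_i + c i)%N) => i j e.
  by have /forallP/(_ j)/implyP := Rc i; apply; apply/eqP.
exists t; split=> //; apply/vstripP => i; have [lt|ge] := ltnP i N; last first.
  by rewrite !nth_default // (leq_trans _ ge).
by have := ltn_ord (c (Ordinal lt)); rewrite (et (Ordinal lt)) /=; lia.
Qed.

Lemma mpoly_double0 N (v : {mpoly int[N]}) : v *+ 2 = 0 -> v = 0.
Proof.
move=> e; apply/mpolyP => m; have /mpolyP/(_ m) := e; rewrite mcoeffMn mcoeff0 mulr2n.
by lia.
Qed.

(* The terms violating an interlacing condition in row [i1 = i0 + 1], but in no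
   later row, cancel in pairs: exchange the exponents of rows [i0] and [i1]. *)
Lemma bounded_hsym_interlace N r s : is_part s -> forall t,
  \sum_(c : {ffun 'I_N -> 'I_r.+1} | (\sum_i c i)%N == r)
     alt (@mvar N) (fun i => s`_i + (N - i.+1) + c i)%N =
  \sum_(c : {ffun 'I_N -> 'I_r.+1} | ((\sum_i c i)%N == r) &&
     [forall i : 'I_N, forall j : 'I_N, (i.+1 == j) && (N - t <= j)%N ==> (s`_j + c j <= s`_i)%N])
     alt (@mvar N) (fun i => s`_i + (N - i.+1) + c i)%N.
Proof.
move=> ps; elim=> [|t ->].
  apply: eq_bigl => c; rewrite [X in _ && X](_ : _ = true) ?andbT //.
  apply/forallP=> i; apply/forallP=> j; apply/implyP=> /andP[_].
  by rewrite subn0 leqNgt ltn_ord.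
pose A d (c : {ffun 'I_N -> 'I_r.+1}) := [forall i : 'I_N, forall j : 'I_N,
  (i.+1 == j) && (N - d <= j)%N ==> (s`_j + c j <= s`_i)%N].
have sub c : A t.+1 c -> A t c.
  move=> /forallP h; apply/forallP=> i; apply/forallP=> j; apply/implyP=> /andP[h1 h2].
  by have /forallP/(_ j)/implyP := h i; apply; rewrite h1 (leq_trans _ h2) // leq_sub2l.
rewrite (bigID (A t.+1)) /= [X in _ + X](_ : _ = 0) ?addr0.
  by apply: eq_bigl => c; rewrite -andbA; congr (_ && _); apply/andb_idl/sub.
have [tN|Nt] := ltnP t.+1 N; last first.
  rewrite big1 // => c /andP[/andP[_ h] /negP[]]; move: h => /forallP h.
  apply/forallP=> i; apply/forallP=> j; apply/implyP=> /andP[/eqP e h2].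
  by have /forallP/(_ j)/implyP := h i; apply; rewrite e eqxx /=; lia.
have lt1 : (N - t.+1 < N)%N by lia.
have lt0 : (N - t.+2 < N)%N by lia.
pose i1 := Ordinal lt1; pose i0 := Ordinal lt0.
have ne : i0 != i1 by rewrite -val_eqE /=; lia.
(* The [1] is the difference of the staircase exponents of adjacent rows. The subtractions are
   exact, by the failure of interlacing ([viol]) and because [s] decreases; the two entries keep
   their sum, hence stay at most [r]. *)
pose f (c : {ffun 'I_N -> 'I_r.+1}) : {ffun 'I_N -> 'I_r.+1} := [ffun i : 'I_N =>
  if i == i1 then inord (s`_i0 + 1 + c i0 - s`_i1)
  else if i == i0 then inord (s`_i1 + c i1 - (s`_i0 + 1)) else c i].
pose G (c : {ffun 'I_N -> 'I_r.+1}) := alt (@mvar N) (fun i => s`_i + (N - i.+1) + c i)%N.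
pose P (c : {ffun 'I_N -> 'I_r.+1}) := ((\sum_i c i)%N == r) && A t c && ~~ A t.+1 c.
suff fP (c : {ffun 'I_N -> 'I_r.+1}) : P c -> [/\ P (f c), f (f c) = c & G (f c) = - G c].
  exact: (@sum_antiinvol _ _ P G f (@mpoly_double0 N)).
rewrite /P /G => /andP[/andP[/eqP sc Atc] nA].
have sum2 (c' : {ffun 'I_N -> 'I_r.+1}) : (\sum_i c' i)%N =
    (c' i1 + c' i0 + \sum_(i | (i != i1) && (i != i0)) c' i)%N.
  by rewrite (bigD1 i1) //= (bigD1 i0) /= ?addnA //.
have viol : (s`_i0 < s`_i1 + c i1)%N.
  rewrite ltnNge; apply: contra nA => le; apply/forallP=> i; apply/forallP=> j.
  apply/implyP=> /andP[/eqP e]; rewrite leq_eqVlt => /orP[/eqP e1|lt].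
    have -> : j = i1 by apply: val_inj; rewrite /= -e1.
    by have -> : i = i0 by apply: val_inj; rewrite /=; move: e e1; lia.
  by have /forallP/(_ i)/forallP/(_ j)/implyP := Atc; apply; rewrite e eqxx /=; lia.
have s10 : (s`_i1 <= s`_i0)%N by apply: part_ge => //=; lia.
have ler : (c i1 + c i0 <= r)%N by apply: leq_trans (eq_leq sc); rewrite sum2 leq_addr.
have f1 : f c i1 = (s`_i0 + 1 + c i0 - s`_i1)%N :> nat.
  by rewrite ffunE eqxx inordK //; lia.
have f0 : f c i0 = (s`_i1 + c i1 - (s`_i0 + 1))%N :> nat.
  by rewrite ffunE (negbTE ne) eqxx inordK //; lia.
have fo i : i != i1 -> i != i0 -> f c i = c i.
  by move=> h1 h0; rewrite ffunE (negbTE h1) (negbTE h0).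
split.
- rewrite sum2 f1 f0 (eq_bigr (fun i => c i : nat)) => [|i /andP[h1 h0]]; last by rewrite fo.
  apply/andP; split; [apply/andP; split|].
  + apply/eqP; move: (sum2 c); rewrite sc => e; apply: etrans (esym e); congr (_ + _)%N; lia.
  + apply/forallP=> i; apply/forallP=> j; apply/implyP=> /andP[/eqP e h2].
    rewrite fo; first by have /forallP/(_ i)/forallP/(_ j)/implyP := Atc; apply; rewrite e eqxx.
      by rewrite -val_eqE /=; move: h2; lia.
    by rewrite -val_eqE /=; move: h2; lia.
  apply/negP=> /forallP/(_ i0)/forallP/(_ i1)/implyP; rewrite f1.
  have -> : (i0.+1 == i1)%N by rewrite /=; lia.
  by rewrite leqnn => /(_ isT); lia.
- apply/ffunP=> i; rewrite {1}/f ffunE; have [->|h1] := eqVneq i i1.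
    apply: ord_inj; rewrite f0 inordK; last by lia.
    by change (s`_i0 + 1 + (s`_i1 + c i1 - (s`_i0 + 1)) - s`_i1 = c i1)%N; lia.
  have [->|h0] := eqVneq i i0; last by rewrite fo.
  apply: ord_inj; rewrite f1 inordK; last by lia.
  by change (s`_i1 + (s`_i0 + 1 + c i0 - s`_i1) - (s`_i0 + 1) = c i0)%N; lia.
rewrite -[RHS]mulN1r -[-1]expr1 -[X in (-1) ^+ X]/(nat_of_bool true).
have -> : true = tperm i0 i1 :> bool by rewrite odd_tperm ne.
have e01 : i1 = i0.+1 :> nat by rewrite /=; lia.
have := ltn_ord i1; rewrite -alt_perm => ltN; apply: eq_alt => // i /=; case: tpermP => [->|->|h0 h1].
- by rewrite f0; lia.
- by rewrite f1; lia.
by rewrite fo //; apply/eqP.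
Qed.

Lemma pieri_h N r s : is_part s ->
  bounded_hsym r.+1 r (@mvar N) * schur_num N s =
  \sum_(t <- partitions_of (sumn s + r) | hstrip s t) schur_num N t.
Proof.
move=> ps; have [les|gts] := leqP (size s) N; last first.
  rewrite /schur_num leqNgt gts mulr0 big_seq_cond big1 // => t.
  rewrite mem_partitions => /andP[/andP[pt _] /hstripP h].
  have lt0 : (0 < s`_N)%N by rewrite part_nth_gt0.
  by rewrite leqNgt -part_nth_gt0 // (leq_trans lt0) //; case: (h N).
rewrite (schur_num_strip _ _ les) schur_numE // bounded_hsym_alt (bounded_hsym_interlace _ _ ps N).
pose R (c : {ffun 'I_N -> 'I_r.+1}) := [forall i : 'I_N, forall j : 'I_N,
  (i.+1 == j) && (N - N <= j)%N ==> (s`_j + c j <= s`_i)%N].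
apply: etrans (@strip_sum _ hstrip N r r s R
  (fun f => alt (@mvar N) (fun i => f i + (N - i.+1))%N) ps les _ _ _).
- by apply: eq_bigr => c _; apply: eq_alt => // i; rewrite addnAC.
- by move=> f g e; apply: eq_alt => // i; rewrite e.
- move=> t pt st /hstripP h es.
  have E (i : 'I_N) : t`_i = (s`_i + (inord (t`_i - s`_i) : 'I_r.+1))%N.
    have [h1 h2] := h i; rewrite inordK ?subnKC // ltnS leq_subLR.
    move: es; rewrite (sumn_nth st) (sumn_nth les) (bigD1 i) //= [(\sum_(j < N) s`_j)%N](bigD1 i) //=.
    have : (\sum_(j < N | j != i) s`_j <= \sum_(j < N | j != i) t`_j)%N.
      by apply: leq_sum => j _; case: (h j).
    have aux (x y z w : nat) : (z <= w -> x + w = y + z + r -> x <= y + r)%N by lia.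
    exact: aux.
  exists [ffun i : 'I_N => inord (t`_i - s`_i)]; last by move=> i; rewrite ffunE.
  apply/forallP=> i; apply/forallP=> j; apply/implyP=> /andP[/eqP e _].
  by rewrite !ffunE -!E -e; case: (h i).
move=> c /forallP Rc sc.
have Rc' (i j : 'I_N) : i.+1 = j -> (s`_j + c j <= s`_i)%N.
  by move=> e; have /forallP/(_ j)/implyP := Rc i; apply; rewrite e eqxx subnn.
have [t [pt st et]] : exists t, [/\ is_part t, (size t <= N)%N &
    forall i : 'I_N, t`_i = (s`_i + c i)%N].
  apply: (@fun_part _ (fun i => s`_i + c i)%N) => i j e.
  by rewrite (leq_trans (Rc' _ _ e)) ?leq_addr.
exists t; split=> //; apply/hstripP => i; have [lt|ge] := ltnP i N; last first.
  by rewrite !nth_default ?(leq_trans les ge) ?(leq_trans st ge) ?(leq_trans st (leqW ge)).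
split; first by rewrite (et (Ordinal lt)) leq_addr.
have [lt'|ge] := ltnP i.+1 N; first by rewrite (et (Ordinal lt')) (Rc' (Ordinal lt)).
by rewrite nth_default // (leq_trans st).
Qed.

End Pieri.

(** * Littlewood-Richardson coefficients *)

Lemma sumn_le s t : (forall i, s`_i <= t`_i) -> sumn s <= sumn t.
Proof.
move=> h; rewrite (sumn_nth (leq_maxl (size s) (size t))) (sumn_nth (leq_maxr (size s) (size t))).
exact: leq_sum.
Qed.

Lemma part_sumn_eq s t : is_part s -> is_part t -> (forall i, s`_i <= t`_i) ->
  sumn s = sumn t -> s = t.
Proof.
move=> ps pt h; set N := maxn (size s) (size t).
have [hs ht] : size s <= N /\ size t <= N by rewrite leq_maxl leq_maxr.
rewrite (sumn_nth hs) (sumn_nth ht) => e.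
have [_] := leqif_sum (fun (i : 'I_N) (_ : true) => leqif_eq (h i)).
rewrite e eqxx => /esym/forallP eqi; apply: part_ext => // i.
have [lt|ge] := ltnP i N; first by apply/eqP/(eqi (Ordinal lt)).
by rewrite !nth_default // (leq_trans _ ge).
Qed.

Section LR.
Import GRing.Theory.
Local Open Scope ring_scope.

Lemma sdecr_part N s : is_part s -> sdecr (fun i : 'I_N => s`_i + (N - i.+1))%N.
Proof. by move=> ps i j lt; have := part_ge ps (ltnW lt); have := ltn_ord j; lia. Qed.

Definition schur_mon N (s : seq nat) : 'X_{1..N} := [multinom (s`_i + (N - i.+1))%N | i < N].

Lemma schur_num_coeff N s t : is_part s -> is_part t -> (size t <= N)%N ->
  (schur_num N s)@_(schur_mon N t) = (s == t)%:R.
Proof.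
move=> ps pt st; have [les|gts] := leqP (size s) N; last first.
  rewrite /schur_num leqNgt gts mcoeff0; case: eqP => // e.
  by move: gts; rewrite e ltnNge st.
rewrite schur_numE // alt_coeff; do ?exact: sdecr_part.
congr (nat_of_bool _)%:R; apply/forallP/eqP => [h|-> //].
apply: part_ext => // i; have [lt|ge] := ltnP i N.
  by have /eqP/addIn := h (Ordinal lt).
by rewrite !nth_default // (leq_trans _ ge).
Qed.

Lemma schur_num0_neq0 N : schur_num N [::] != 0.
Proof.
apply/eqP => e; have := @schur_num_coeff N [::] [::] isT isT isT.
by rewrite e mcoeff0.
Qed.

Lemma schur_sum_coeff N m (x : seq nat -> nat) t : is_part t -> (size t <= N)%N ->
  sumn t = m ->
  (\sum_(s <- partitions_of m) schur_num N s *+ x s)@_(schur_mon N t) = (x t)%:R.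
Proof.
move=> pt st et; rewrite raddf_sum /=.
have tP : t \in partitions_of m by rewrite mem_partitions pt et eqxx.
rewrite (bigD1_seq t) ?partitions_uniq //= mcoeffMn schur_num_coeff // eqxx.
rewrite big_seq_cond big1 ?addr0 // => s /andP[]; rewrite mem_partitions => /andP[ps _] ne.
by rewrite mcoeffMn schur_num_coeff // (negbTE ne) mul0rn.
Qed.

Variable c : seq nat -> seq nat -> seq nat -> nat.
Hypothesis LRc : LR_coefficients c.

Lemma LR_sumn lam mu rho : is_part lam -> is_part mu -> is_part rho ->
  c lam mu rho != 0%N -> sumn rho = (sumn lam + sumn mu)%N.
Proof. by case: LRc => h _ pl pm pr /eqP; apply: h. Qed.

(** The defining relation with denominators cleared; one Vandermonde factor [schur_num N [::]]
    remains on the right. *)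
Lemma LR_mul N lam mu : is_part lam -> is_part mu ->
  schur_num N lam * schur_num N mu = schur_num N [::] *
    \sum_(rho <- partitions_of (sumn lam + sumn mu)) schur_num N rho *+ c lam mu rho.
Proof.
case: LRc => _ h pl pm; have /= := h N lam mu pl pm.
have schurE s : schur N s = tofrac (schur_num N s) / tofrac (schur_num N [::]).
  by rewrite /schur /schur_num; case: ifP => //; rewrite rmorph0 mul0r.
have nz : tofrac (schur_num N [::]) != 0 by rewrite tofrac_eq0 schur_num0_neq0.
rewrite -big_filter (eq_bigr (fun rho => tofrac (schur_num N rho *+ c lam mu rho)
   / tofrac (schur_num N [::]))); last by move=> s _; rewrite schurE rmorphMn mulrnAl.
rewrite -mulr_suml !schurE -rmorph_sum /= => e; apply/eqP; rewrite -tofrac_eq !rmorphM /=.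
move: nz e; set d := tofrac (schur_num N [::]) => nz e.
rewrite [d * _]mulrC -[X in X * d](divfK nz) -e (mulrAC _ d^-1) divfK // mulrA divfK //.
Qed.

Lemma LR_vec_inj N m (x y : seq nat -> nat) :
  \sum_(s <- partitions_of m) schur_num N s *+ x s =
  \sum_(s <- partitions_of m) schur_num N s *+ y s ->
  forall t, is_part t -> (size t <= N)%N -> sumn t = m -> x t = y t.
Proof.
move=> e t pt st et; have := schur_sum_coeff x pt st et.
by rewrite e schur_sum_coeff // => /eqP; rewrite Num.Theory.eqr_nat => /eqP.
Qed.

Lemma LR_sym lam mu rho : is_part lam -> is_part mu -> is_part rho ->
  c lam mu rho = c mu lam rho.
Proof.
move=> pl pm pr; have [e|ne] := eqVneq (sumn rho) (sumn lam + sumn mu)%N; last first.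
  have [e1|/(LR_sumn pl pm pr) e] := eqVneq (c lam mu rho) 0%N.
    have [e2|/(LR_sumn pm pl pr) e] := eqVneq (c mu lam rho) 0%N; first by rewrite e1 e2.
    by rewrite addnC e eqxx in ne.
  by rewrite e eqxx in ne.
have := LR_mul (size rho) pl pm; rewrite mulrC LR_mul // => /(mulfI (schur_num0_neq0 _)).
by rewrite [(sumn mu + _)%N]addnC => /LR_vec_inj->.
Qed.

Lemma LR_nil mu rho : is_part mu -> is_part rho -> c [::] mu rho = (rho == mu).
Proof.
move=> pm pr; have [e|ne] := eqVneq (sumn rho) (sumn mu); last first.
  have [->|/(LR_sumn (lam := [::]) isT pm pr) e] := eqVneq (c [::] mu rho) 0%N.
    by case: (eqVneq rho mu) ne => [->|//]; rewrite eqxx.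
  by rewrite e eqxx in ne.
have := @LR_mul (size rho) [::] mu isT pm => /(mulfI (schur_num0_neq0 _)); rewrite /= add0n.
have -> : schur_num (size rho) mu = \sum_(s <- partitions_of (sumn mu))
    schur_num (size rho) s *+ (s == mu).
  rewrite (bigD1_seq mu) ?partitions_uniq ?mem_partitions ?pm //= eqxx mulr1n.
  by rewrite big1 ?addr0 // => s /negbTE->.
by move/LR_vec_inj/(_ rho pr (leqnn _) e).
Qed.

(** What vertical and horizontal strips have in common; [g] stands for the elementary or the
    complete symmetric polynomial of degree [r]. *)
Definition pieri_rel (strip : rel (seq nat)) : Prop :=
  (forall s t, strip s t -> forall i, (s`_i <= t`_i)%N) /\
  (forall N r, exists g : {mpoly int[N]}, forall s, is_part s ->
     g * schur_num N s = \sum_(t <- partitions_of (sumn s + r) | strip s t) schur_num N t).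

Lemma pieri_vstrip : pieri_rel vstrip.
Proof.
split=> [s t /vstripP h i|N r]; first by case/andP: (h i).
by exists (bounded_hsym 2 r (@mvar N)) => s; apply: pieri_v.
Qed.

Lemma pieri_hstrip : pieri_rel hstrip.
Proof.
split=> [s t /hstripP h i|N r]; first by case: (h i).
by exists (bounded_hsym r.+1 r (@mvar N)) => s; apply: pieri_h.
Qed.

(** Associativity: [g] is multiplied either into the factor of [lam] or into the whole product, and
    the coefficients of [rho] are compared. With [size rho] variables the Schur polynomial of [rho]
    survives. *)
Lemma LR_rec strip lam mu rho r : pieri_rel strip ->
  is_part lam -> is_part mu -> is_part rho -> sumn rho = (sumn lam + r + sumn mu)%N ->
  (\sum_(tau <- partitions_of (sumn lam + r) | strip lam tau) c tau mu rho)%N =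
  (\sum_(sig <- partitions_of (sumn lam + sumn mu) | strip sig rho) c lam mu sig)%N.
Proof.
move=> [_ /(_ (size rho) r)[g gP]] pl pm pr er; set N := size rho in g gP.
have e1 : (g * schur_num N lam) * schur_num N mu = schur_num N [::] *
    \sum_(s <- partitions_of (sumn lam + r + sumn mu)) schur_num N s *+
      \sum_(tau <- partitions_of (sumn lam + r) | strip lam tau) c tau mu s.
  rewrite gP // mulr_suml; under [X in _ * X]eq_bigr => s _ do rewrite -sumrMnr.
  rewrite exchange_big mulr_sumr /= big_seq_cond [RHS]big_seq_cond.
  apply: eq_bigr => t /andP[]; rewrite mem_partitions => /andP[pt /eqP et] _.
  by rewrite LR_mul // et.
have e2 : g * (schur_num N lam * schur_num N mu) = schur_num N [::] *
    \sum_(s <- partitions_of (sumn lam + r + sumn mu)) schur_num N s *+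
      \sum_(sig <- partitions_of (sumn lam + sumn mu) | strip sig s) c lam mu sig.
  rewrite LR_mul // mulrCA mulr_sumr; congr (_ * _).
  under [RHS]eq_bigr => s _ do rewrite -sumrMnr big_mkcond.
  rewrite exchange_big /= big_seq [RHS]big_seq.
  apply: eq_bigr => t; rewrite mem_partitions => /andP[pt /eqP et].
  by rewrite mulrnAr gP // -big_mkcond sumrMnl et [(sumn lam + r + _)%N]addnAC.
move: e1; rewrite -mulrA e2 => /(mulfI (schur_num0_neq0 _))/LR_vec_inj h.
by rewrite h.
Qed.

(* As [c] is nonnegative, a nonzero term on one side of [LR_rec] forces one on
   the other side. *)
Lemma LR_reach_down strip kap tau mu rho : pieri_rel strip ->
  is_part kap -> is_part tau -> is_part mu -> is_part rho ->
  strip kap tau -> c tau mu rho != 0%N ->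
  exists sig, [/\ is_part sig, strip sig rho & c kap mu sig != 0%N].
Proof.
move=> ps pk pt pm pr str nz; have le := sumn_le (ps.1 _ _ str).
have e := LR_sumn pt pm pr nz; rewrite -(subnKC le) in e.
have E := LR_rec ps pk pm pr e.
have : (\sum_(sig <- partitions_of (sumn kap + sumn mu) | strip sig rho) c kap mu sig != 0)%N.
  rewrite -E sum_nat_seq_neq0; apply/hasP; exists tau; last by rewrite str nz.
  by rewrite mem_partitions pt subnKC /=.
rewrite sum_nat_seq_neq0 => /hasP[sig]; rewrite mem_partitions => /andP[psg _] /andP[h1 h2].
by exists sig.
Qed.

Lemma LR_reach_up strip kap sig mu rho : pieri_rel strip ->
  is_part kap -> is_part sig -> is_part mu -> is_part rho ->
  strip sig rho -> c kap mu sig != 0%N ->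
  exists tau, [/\ is_part tau, strip kap tau & c tau mu rho != 0%N].
Proof.
move=> ps pk psg pm pr str nz; have le := sumn_le (ps.1 _ _ str).
have e := LR_sumn pk pm psg nz.
have er : sumn rho = (sumn kap + (sumn rho - sumn sig) + sumn mu)%N.
  by rewrite addnAC -e subnKC.
have E := LR_rec ps pk pm pr er.
have : (\sum_(tau <- partitions_of (sumn kap + (sumn rho - sumn sig)) | strip kap tau)
    c tau mu rho != 0)%N.
  rewrite E sum_nat_seq_neq0; apply/hasP; exists sig; last by rewrite str nz.
  by rewrite mem_partitions psg e /=.
rewrite sum_nat_seq_neq0 => /hasP[tau]; rewrite mem_partitions => /andP[pt _] /andP[h1 h2].
by exists tau.
Qed.

Lemma drop_col s : is_part s -> exists t,
  [/\ is_part t, forall i, t`_i = (s`_i).-1, (size t <= size s)%N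
    & sumn s = (sumn t + size s)%N].
Proof.
move=> ps; have [||pt nt st] := @mkpartP (size s) (fun i => (s`_i).-1).
- by move=> i; have := part_geS i ps; lia.
- by rewrite nth_default.
exists (mkpart (size s) (fun i => (s`_i).-1)); split=> //.
rewrite sumn_mkpart (sumn_nth (leqnn (size s))) -[X in (_ + X)%N](card_ord (size s)) -sum1_card -big_split.
by apply: eq_bigr => i _; rewrite /= addn1 prednK // part_nth_gt0.
Qed.

Lemma drop_col_vstrip s t : is_part s -> (forall i, t`_i = (s`_i).-1) -> vstrip t s.
Proof. by move=> ps h; apply/vstripP => i; rewrite h; lia. Qed.

(* Both sides satisfy the recursion [LR_rec] for vertical strips, which
   determines [c]: let [kap] be [lam] without its first column; a vertical strip
   of the same size added to [kap] gives [lam] or a partition with more rows. *)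
Lemma LR_conjp lam mu rho : is_part lam -> is_part mu -> is_part rho ->
  c (conjp lam) (conjp mu) (conjp rho) = c lam mu rho.
Proof.
move=> pl pm; have [n] := ubnP (sumn lam); elim: n lam pl rho => // n IHn lam pl rho.
(* At fixed size the induction runs upwards in the number of rows, which never exceeds the size. *)
have [m] := ubnP (n - size lam); elim: m lam pl rho => // m IHm lam pl rho ltm ltn pr.
have [e|ne] := eqVneq (sumn rho) (sumn lam + sumn mu)%N; last first.
  have [e1|/(LR_sumn pl pm pr) e] := eqVneq (c lam mu rho) 0%N; last by rewrite e eqxx in ne.
  have [-> //|/LR_sumn] := eqVneq (c (conjp lam) (conjp mu) (conjp rho)) 0%N.
  by rewrite !sumn_conjp // => h; rewrite h ?conjp_part ?eqxx in ne.
case: (posnP (size lam)) => [/size0nil->|lam0].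
  rewrite [conjp [::]]/= !LR_nil ?conjp_part //; congr nat_of_bool.
  by apply/eqP/eqP => [h|-> //]; rewrite -(conjpK pr) h conjpK.
have [kap [pk nk sk ek]] := drop_col pl; pose r := size lam; rewrite -/r in ek; have r0 : (0 < r)%N by [].
have vkl := drop_col_vstrip pl nk.
have lP : lam \in partitions_of (sumn kap + r) by rewrite mem_partitions pl ek /=.
have big (t : seq nat) : t \in partitions_of (sumn kap + r) -> vstrip kap t -> t != lam ->
    c (conjp t) (conjp mu) (conjp rho) = c t mu rho.
  rewrite mem_partitions => /andP[pt /eqP et] /vstripP h ne.
  have gt : (size lam < size t)%N.
    rewrite ltnNge; apply: contra ne => le; apply/eqP/part_sumn_eq; rewrite ?ek // => i.
    have [lt|ge] := ltnP i (size lam); last by rewrite nth_default // (leq_trans le).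
    have := h i; have : (0 < lam`_i)%N by rewrite part_nth_gt0.
    by rewrite nk; lia.
  have := size_le_sumn pt; rewrite et -ek => lt; apply: IHm => //; [lia|by rewrite et -ek].
have ltk : (sumn kap < n)%N by lia.
have e1 : sumn rho = (sumn kap + r + sumn mu)%N by rewrite e ek.
have := LR_rec pieri_vstrip pk pm pr e1.
have E2 := LR_rec pieri_hstrip (conjp_part pk) (conjp_part pm) (conjp_part pr).
move: (E2 r); rewrite !sumn_conjp // => /(_ e1).
(* Reindexing by transposes turns the horizontal strips of the second recursion into the vertical
   strips of the first, so that both sums run over the same partitions. *)
rewrite -(perm_big _ (perm_partitions_conjp _)) -[RHS](perm_big _ (perm_partitions_conjp _)) /=.
rewrite !big_map big_seq_cond [RHS]big_seq_cond.
rewrite (eq_big (fun t => (t \in partitions_of (sumn kap + r)) && vstrip kap t)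
  (fun t => c (conjp t) (conjp mu) (conjp rho))) //; last first.
  by move=> t; case: (boolP (t \in _)) => //; rewrite mem_partitions => /andP[pt _]; rewrite hstrip_conjp.
rewrite [in RHS](eq_big (fun t => (t \in partitions_of (sumn kap + sumn mu)) && vstrip t rho)
  (fun t => c kap mu t)); first last.
- move=> t /andP[]; rewrite mem_partitions => /andP[pt _] _; exact: IHn.
- by move=> t; case: (boolP (t \in _)) => //; rewrite mem_partitions => /andP[pt _]; rewrite hstrip_conjp.
rewrite -!big_seq_cond => + E; rewrite -E.
rewrite !(bigID (pred1 lam) (vstrip kap)) /=.
have one (F : seq nat -> nat) : (\sum_(t <- partitions_of (sumn kap + r) |
    vstrip kap t && (t == lam)) F t)%N = F lam.
  rewrite -big_filter (_ : [seq t <- _ | _] = [:: lam]) ?big_seq1 //.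
  apply: perm_small_eq => //; apply: uniq_perm => //.
    exact/filter_uniq/partitions_uniq.
  move=> t; rewrite mem_filter inE andbC; case: eqP => [->|]; last by rewrite !andbF.
  by rewrite lP vkl.
rewrite !one big_seq_cond [in RHS]big_seq_cond.
rewrite (eq_bigr (fun t => c t mu rho)) => [/addIn //|t /andP[h1 /andP[h2 h3]]].
exact: big.
Qed.

End LR.

(** * Complements in a rectangle and inequalities for Littlewood-Richardson coefficients *)

Lemma dual_partP l M s : is_part s ->
  [/\ is_part (dual_part l M s), forall i, i < l -> (dual_part l M s)`_i = M - s`_(l - i.+1),
      size (dual_part l M s) <= l & head 0 (dual_part l M s) <= M].
Proof.
move=> ps; pose g i := if i < l then M - s`_(l - i.+1) else 0.
have E : dual_part l M s = mkpart l g.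
  rewrite /dual_part /mkpart; congr drop_zeros; apply/eq_in_map => i.
  by rewrite mem_iota /g => /andP[_ ->].
have [||pt nt st] := @mkpartP l g.
- move=> i; rewrite /g; case: ltnP => // lt; rewrite (ltnW lt) leq_sub2l //.
  by apply: part_ge => //; lia.
- by rewrite /g ltnn.
rewrite E; split=> // [i lt|]; first by rewrite nt /g lt.
by rewrite head_nth0 nt /g; case: ifP => _; rewrite ?leq_subr.
Qed.

Section LRbounds.
Variable c : seq nat -> seq nat -> seq nat -> nat.
Hypothesis LRc : LR_coefficients c.

Lemma LR_nil_neq0 mu rho : is_part mu -> is_part rho -> c [::] mu rho != 0 -> rho = mu.
Proof. by move=> pm pr; rewrite (LR_nil LRc) //; case: (rho =P mu). Qed.

Lemma part_nil s : is_part s -> s`_0 = 0 -> s = [::].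
Proof. by move=> ps e; apply: size0nil; apply/eqP; rewrite -leqn0 leqNgt -part_nth_gt0 // e. Qed.

(* Strip the first [p] rows (horizontal strips), then the remaining columns
   (vertical strips), off [lam], and follow [rho] with [LR_reach_down]. *)
Lemma LR_upper lam mu rho p q : is_part lam -> is_part mu -> is_part rho ->
  c lam mu rho != 0 -> rho`_(p + q) <= lam`_p + mu`_q.
Proof.
move=> pl pm; elim: p lam pl rho => [|p IH] lam pl rho pr nz.
  rewrite add0n; move e : (lam`_0) => n; elim: n lam pl rho pr e nz => [|n IH] lam pl rho pr e nz.
    by rewrite (part_nil pl e) in nz; rewrite (LR_nil_neq0 pm pr nz).
  have [kap [pk nk _ _]] := drop_col pl.
  have [sig [psg /vstripP h nz']] := LR_reach_down LRc pieri_vstrip pk pl pm pr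
    (drop_col_vstrip pl nk) nz.
  have := IH _ pk _ psg _ nz'; rewrite nk e => /(_ erefl); have := h q; lia.
case: lam pl nz => [|x s] pl nz.
  by rewrite (LR_nil_neq0 pm pr nz) nth_nil part_ge // leq_addl.
have ps : is_part s.
  apply: is_partP => i; first exact: (part_geS i.+1 pl).
  by move=> lt; have := @part_nth_gt0 _ i.+1 pl; rewrite /= ltnS lt.
have hs : hstrip s (x :: s) by apply/hstripP => i; split=> //; apply: (part_geS i pl).
have [sig [psg /hstripP h nz']] := LR_reach_down LRc pieri_hstrip ps pl pm pr hs nz.
by rewrite addSn; apply: leq_trans (proj2 (h _)) (IH _ ps _ psg nz').
Qed.

(** Stripping the columns of [lam] only shrinks [rho], and when [lam] is exhausted what is left of
    [rho] is [mu]. *)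
Lemma LR_contain_r lam mu rho i : is_part lam -> is_part mu -> is_part rho ->
  c lam mu rho != 0 -> mu`_i <= rho`_i.
Proof.
move=> pl pm; move e : (lam`_0) => n; elim: n lam pl rho e => [|n IH] lam pl rho e pr nz.
  by rewrite (part_nil pl e) in nz; rewrite (LR_nil_neq0 pm pr nz).
have [kap [pk nk _ _]] := drop_col pl.
have [sig [psg /vstripP h nz']] := LR_reach_down LRc pieri_vstrip pk pl pm pr
  (drop_col_vstrip pl nk) nz.
by apply: leq_trans (proj1 (andP (h i))); apply: IH pk _ _ psg nz'; rewrite nk e.
Qed.

Lemma LR_contain_l lam mu rho i : is_part lam -> is_part mu -> is_part rho ->
  c lam mu rho != 0 -> lam`_i <= rho`_i.
Proof. by move=> pl pm pr; rewrite (LR_sym LRc) //; apply: LR_contain_r. Qed.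

Lemma contain_size s t : is_part s -> is_part t -> (forall i, s`_i <= t`_i) -> size s <= size t.
Proof.
move=> ps pt h; rewrite leqNgt -part_nth_gt0 // -leqNgt leqn0 -leqn0.
by rewrite (leq_trans (h _)) // nth_default.
Qed.

Section Eval.
Import GRing.Theory.
Local Open Scope ring_scope.

Definition altp (S : comNzRingType) N (y : 'I_N -> S) (s : seq nat) : S :=
  alt y (fun i => s`_i + (N - i.+1))%N.

Lemma mmap_schur_num (S : comNzRingType) N (y : 'I_N -> S) s : (size s <= N)%N ->
  mmap intr y (schur_num N s) = altp y s.
Proof.
move=> st; rewrite schur_numE // alt_rmorph; apply: eq_alt => // j.
by rewrite /= /mvar mmapX mmap1U.
Qed.

Lemma LR_altp (S : comNzRingType) N (y : 'I_N -> S) lam mu : is_part lam -> is_part mu ->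
  (size lam <= N)%N -> (size mu <= N)%N ->
  altp y lam * altp y mu = altp y [::] *
    \sum_(rho <- partitions_of (sumn lam + sumn mu) | (size rho <= N)%N) altp y rho *+ c lam mu rho.
Proof.
move=> pl pm sl sm; rewrite -!mmap_schur_num // -rmorphM (LR_mul LRc) // rmorphM; congr (_ * _).
rewrite rmorph_sum (bigID (fun rho : seq nat => size rho <= N)%N) /= [X in _ + X]big1 ?addr0.
  by apply: eq_bigr => rho st; rewrite rmorphMn /= mmap_schur_num.
by move=> rho /negbTE h; rewrite /schur_num h mul0rn rmorph0.
Qed.

Lemma alt_inv (F : fieldType) N (y : 'I_N -> F) (b : 'I_N -> nat) K :
  (forall j, y j != 0) -> (forall i, b i <= K)%N ->
  (\prod_j y j) ^+ K * alt (fun j => (y j)^-1) b = alt y (fun i => K - b i)%N.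
Proof.
move=> nz le; rewrite !altE mulr_sumr; apply: eq_bigr => s _; rewrite mulrCA; congr (_ * _).
rewrite -prodrXl (reindex_inj (@perm_inj _ s)) /= -big_split /=; apply: eq_bigr => i _.
by rewrite exprVn -expfB_cond ?(negbTE (nz _)) ?add0n.
Qed.

(** Inverting the variables negates the exponents; adding their largest possible value [M + k.-1]
    gives the exponents of the complement in reverse order, whence the sign of the reversal. *)
Lemma altp_dual (F : fieldType) k M (y : 'I_k -> F) s : (forall j, y j != 0) ->
  is_part s -> (s`_0 <= M)%N ->
  (\prod_j y j) ^+ (M + k.-1) * altp (fun j => (y j)^-1) s =
  (-1) ^+ perm (@rev_ord_inj k) * altp y (dual_part k M s).
Proof.
move=> nz ps le; have sM i : (s`_i <= M)%N by apply: leq_trans le; apply: part_ge.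
rewrite alt_inv //; last by move=> i; have := sM i; have := ltn_ord i; lia.
rewrite -alt_perm; apply: eq_alt => // i; rewrite /= permE.
have [_ h _ _] := dual_partP k M ps; rewrite h ?ltn_ord //=.
have e : (k - (k - i.+1).+1)%N = i by have := ltn_ord i; lia.
by rewrite !e; have := sM i; have := ltn_ord i; lia.
Qed.

(* Substitute the inverses of the variables. *)
Lemma LR_dual k M lam mu rho : is_part lam -> is_part mu -> is_part rho ->
  (size rho <= k)%N -> (lam`_0 <= M)%N -> (mu`_0 <= M)%N ->
  c lam mu rho != 0%N ->
  c (dual_part k M lam) (dual_part k M mu) (dual_part k (M + M) rho) != 0%N.
Proof.
move=> pl pm pr sr lM mM nz.
have sl : (size lam <= k)%N.
  by apply: leq_trans sr; apply: contain_size => // i; apply: LR_contain_l nz.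
have sm : (size mu <= k)%N.
  by apply: leq_trans sr; apply: contain_size => // i; apply: LR_contain_r nz.
pose y (j : 'I_k) : {fraction {mpoly int[k]}} := tofrac 'X_j.
have ynz j : y j != 0.
  rewrite tofrac_eq0; apply/eqP => /(congr1 (mcoeff U_(j))) /eqP.
  by rewrite mcoeffXU eqxx mcoeff0.
have altpE s : (size s <= k)%N -> altp y s = tofrac (schur_num k s).
  by move=> st; rewrite schur_numE // alt_rmorph; apply: eq_alt.
set e := (\prod_j y j).
have enz : e != 0 by apply/prodf_neq0 => j _; apply: ynz.
have /(congr1 ( *%R (e ^+ (M + k.-1) * e ^+ (M + k.-1)))) := LR_altp (fun j => (y j)^-1) pl pm sl sm.
rewrite mulrACA !altp_dual //.
(* On the left both factors are complemented with width [M]; on the right the same power is split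
   into width 0 for the Vandermonde and width [M + M] for [rho]. *)
have -> : e ^+ (M + k.-1) * e ^+ (M + k.-1) = e ^+ (0 + k.-1) * e ^+ (M + M + k.-1).
  by rewrite -!exprD; congr (_ ^+ _); lia.
rewrite [RHS]mulrACA altp_dual //.
have d0 : dual_part k 0 [::] = [::].
  have [p1 _ _ h] := @dual_partP k 0 [::] isT.
  by apply: part_nil => //; apply/eqP; rewrite -leqn0 -head_nth0.
rewrite d0; set sg := (-1) ^+ _.
have sg2 : sg * sg = 1 by rewrite -expr2 sqrr_sign.
have -> : e ^+ (M + M + k.-1) * (\sum_(r <- partitions_of (sumn lam + sumn mu) | (size r <= k)%N)
      altp (fun j => (y j)^-1) r *+ c lam mu r) =
    sg * \sum_(r <- partitions_of (sumn lam + sumn mu) | (size r <= k)%N)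
      altp y (dual_part k (M + M) r) *+ c lam mu r.
  rewrite !mulr_sumr big_seq_cond [RHS]big_seq_cond.
  apply: eq_bigr => r /andP[]; rewrite mem_partitions => /andP[p _] _.
  rewrite !mulrnAr; have [->|nz'] := eqVneq (c lam mu r) 0%N; first by rewrite !mulr0n.
  by rewrite altp_dual //; apply: leq_trans (LR_upper 0 0 pl pm p nz') _; lia.
rewrite mulrACA [RHS]mulrACA sg2 !mul1r.
have [pl' _ sl' _] := dual_partP k M pl; have [pm' _ sm' _] := dual_partP k M pm.
have [pr' _ sr' _] := dual_partP k (M + M) pr.
rewrite !altpE // -rmorphM (LR_mul LRc) // rmorphM => /mulfI.
rewrite tofrac_eq0 schur_num0_neq0 => /(_ isT).
have -> : \sum_(r <- partitions_of (sumn lam + sumn mu) | (size r <= k)%N)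
      altp y (dual_part k (M + M) r) *+ c lam mu r =
    tofrac (\sum_(r <- partitions_of (sumn lam + sumn mu) | (size r <= k)%N)
      schur_num k (dual_part k (M + M) r) *+ c lam mu r).
  rewrite rmorph_sum /= big_seq_cond [RHS]big_seq_cond.
  apply: eq_bigr => r /andP[]; rewrite mem_partitions => /andP[p _] _.
  by have [_ _ st _] := dual_partP k (M + M) p; rewrite altpE // rmorphMn.
move=> /eqP; rewrite tofrac_eq => /eqP/(congr1 (mcoeff (schur_mon k (dual_part k (M + M) rho)))).
rewrite !raddf_sum /=.
have cf m (p : pred (seq nat)) (x : seq nat -> nat) (f : seq nat -> seq nat) :
    (forall s, is_part s -> is_part (f s)) ->
    \sum_(s <- partitions_of m | p s)
      (schur_num k (f s) *+ x s)@_(schur_mon k (dual_part k (M + M) rho)) =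
    (\sum_(s <- partitions_of m | p s) (f s == dual_part k (M + M) rho) * x s)%N%:R.
  move=> pf; rewrite natr_sum big_seq_cond [RHS]big_seq_cond.
  apply: eq_bigr => s /andP[]; rewrite mem_partitions => /andP[ps _] _.
  by rewrite mcoeffMn schur_num_coeff ?pf // natrM mulr_natr.
rewrite (cf _ xpredT _ id) // cf; last by move=> s /(dual_partP k (M + M))[].
(* On the left only the coefficient for the dual of [rho] is picked out. On the right all terms are
   nonnegative, so the positive term of [rho] is enough. *)
move/eqP; rewrite Num.Theory.eqr_nat => /eqP E; apply/eqP => E0; move/eqP: E.
rewrite big1 => [|s _]; last by case: eqP => [->|]; rewrite ?E0.
rewrite eq_sym; apply/negP; rewrite sum_nat_seq_neq0; apply/hasP; exists rho.
  by rewrite mem_partitions pr (LR_sumn LRc pl pm pr nz) /=.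
by rewrite sr eqxx mul1n.
Qed.

End Eval.
(** This is [LR_upper] for the complements, read backwards. The two bounds are the analogues of
    Weyl's inequalities for eigenvalues of a sum of Hermitian matrices. *)
Lemma LR_lower k lam mu rho i j : is_part lam -> is_part mu -> is_part rho ->
  size rho <= k -> c lam mu rho != 0 -> i < k -> j < k -> k <= i + j.+1 ->
  lam`_i + mu`_j <= rho`_(i + j.+1 - k).
Proof.
move=> pl pm pr sr nz ik jk kij; set M := lam`_0 + mu`_0.
have := LR_dual pl pm pr sr (leq_addr _ _ : lam`_0 <= M) (leq_addl _ _ : mu`_0 <= M) nz.
have [pl' hl _ _] := dual_partP k M pl; have [pm' hm _ _] := dual_partP k M pm.
have [pr' hr _ _] := dual_partP k (M + M) pr.
move=> /(LR_upper (k.-1 - i) (k.-1 - j) pl' pm' pr').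
rewrite hl ?hm ?hr; [|lia..].
have -> : k - (k.-1 - i + (k.-1 - j)).+1 = i + j.+1 - k by lia.
have -> : k - (k.-1 - i).+1 = i by lia.
have -> : k - (k.-1 - j).+1 = j by lia.
have := part_ge pl (leq0n i); have := part_ge pm (leq0n j); rewrite /M; lia.
Qed.

End LRbounds.

Lemma sumn_dual_part l M s : is_part s -> size s <= l -> head 0 s <= M ->
  sumn (dual_part l M s) + sumn s = l * M.
Proof.
move=> ps st hd; have [_ h sd _] := dual_partP l M ps.
rewrite (sumn_nth sd) (sumn_nth st) [X in _ + X](reindex_inj rev_ord_inj) -big_split /=.
rewrite (eq_bigr (fun=> M)) ?sum_nat_const ?card_ord // => i _.
by rewrite h // subnK // (leq_trans _ hd) // head_nth0 part_ge.
Qed.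

(** * Nonvanishing products inside a rectangle *)

Section Box.
Variable c : seq nat -> seq nat -> seq nat -> nat.
Hypothesis LRc : LR_coefficients c.
Variables (k l : nat).

(** Starting from [mu] itself, the rows are filled up to length [l] from the top down. Each step
    adds a horizontal strip, so [LR_reach_up] keeps a nonzero coefficient until the full rectangle
    is reached. *)
Lemma LR_fill mu : is_part mu -> size mu <= k -> head 0 mu <= l ->
  exists box, [/\ is_part box, size box <= k, head 0 box <= l
    & c (dual_part k l mu) mu box != 0].
Proof.
move=> pm sm hm; have mul i : mu`_i <= l by rewrite (leq_trans _ hm) // head_nth0 part_ge.
pose g s i := if i < s then l else mu`_i.
have F s : s <= k -> [/\ is_part (mkpart k (g s)), forall i, i < k -> (mkpart k (g s))`_i = g s i &
    size (mkpart k (g s)) <= k].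
  move=> sk; have z : g s k = 0 by rewrite /g ltnNge sk nth_default.
  have [||pt nt st] := @mkpartP k (g s) => //.
  move=> i; rewrite /g; case: ltnP => [lt|_]; first by rewrite (ltnW lt).
  by case: ltnP => // _; apply: part_geS.
have step s : s <= k -> exists tau, is_part tau /\ c tau mu (mkpart k (g s)) != 0.
  elim: s => [|s IH] sk; have [p1 n1 s1] := F _ sk.
    exists [::]; split=> //; rewrite (LR_nil LRc) // eqb0 negbK; apply/eqP/part_ext => // i.
    have [lt|ge] := ltnP i k; first by rewrite n1.
    by rewrite !nth_default // (leq_trans _ ge).
  have [tau [pt nz]] := IH (ltnW sk); have [p0 n0 s0] := F _ (ltnW sk).
  have hs : hstrip (mkpart k (g s)) (mkpart k (g s.+1)).
    apply/hstripP => i; have [lt|ge] := ltnP i k; last first.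
      by rewrite !nth_default ?(leq_trans s0 ge) ?(leq_trans s1 ge) ?(leq_trans s1 (leqW ge)).
    rewrite n0 // n1 //; split.
      by rewrite /g ltnS; have := mul i; case: ifP; case: ifP; lia.
    have [lt'|ge] := ltnP i.+1 k; last by rewrite nth_default // (leq_trans s1).
    rewrite n1 // /g ltnS; by case: ltnP => // h; apply: part_geS.
  have [tau' [pt' _ nz']] := LR_reach_up LRc pieri_hstrip pt p0 pm p1 hs nz.
  by exists tau'.
have [tau [pt nz]] := step k (leqnn k); have [pb nb sb] := F k (leqnn k).
have [pd nd sd hd] := dual_partP k l pm.
exists (mkpart k (g k)); split=> //.
  rewrite head_nth0; have [k0|k0] := posnP k; first by rewrite nth_default // k0 in sb *.
  by rewrite nb // /g k0.
(* The partition paired with [mu] is unknown so far. [LR_lower], applied to opposite rows, confines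
   it to the dual of [mu], and the sizes agree. *)
suff <- : tau = dual_part k l mu by [].
have st : size tau <= k.
  by apply: leq_trans sb; apply: contain_size => // i; apply: (LR_contain_l LRc _ pt pm pb nz).
apply: part_sumn_eq => // [i|].
  have [lt|ge] := ltnP i k; last by rewrite nth_default // (leq_trans st).
  have e : i + (k - i.+1).+1 - k = 0 by lia.
  have := LR_lower (j := k - i.+1) LRc pt pm pb sb nz lt; rewrite e nd //.
  have : (mkpart k (g k))`_0 <= l by rewrite nb ?(leq_ltn_trans _ lt) // /g; case: ifP.
  by have := mul (k - i.+1); lia.
apply/eqP; rewrite -(eqn_add2r (sumn mu)) -(LR_sumn LRc pt pm pb nz) sumn_dual_part //.
rewrite (sumn_nth sb) (eq_bigr (fun=> l)) ?sum_nat_const ?card_ord // => i _.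
by rewrite nb // /g ltn_ord.
Qed.

(** The last hypothesis says that [lam] lies in the dual of [mu]. Shrink that dual to [lam],
    removing at most one box per row at each of [l] steps: the third partition starts as the one
    from [LR_fill] and only shrinks, so it stays in the rectangle. This is the classical criterion
    for a nonzero product of Schubert classes. *)
Lemma LR_box lam mu : is_part lam -> is_part mu -> size lam <= k -> size mu <= k ->
  head 0 lam <= l -> head 0 mu <= l ->
  (forall i, i < k -> lam`_i + mu`_(k - i.+1) <= l) ->
  exists sig, [/\ is_part sig, size sig <= k, head 0 sig <= l & c lam mu sig != 0].
Proof.
move=> pl pm sl sm hl hm h; have [box [pb sb hb nz]] := LR_fill pm sm hm.
have [pd nd sd hd] := dual_partP k l pm; set kap := dual_part k l mu in pd nd sd hd nz.
have le i : lam`_i <= kap`_i.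
  have [lt|ge] := ltnP i k; last by rewrite nth_default // (leq_trans sl).
  by rewrite nd //; have := h i lt; lia.
pose g t i := maxn lam`_i (kap`_i - t).
have G t : [/\ is_part (mkpart k (g t)) & forall i, (mkpart k (g t))`_i = g t i].
  have [||pt nt st] := @mkpartP k (g t) => //.
    by move=> i; rewrite /g; have := part_geS i pl; have := part_geS i pd; lia.
  by rewrite /g !nth_default.
have step t : exists sig, [/\ is_part sig, forall i, sig`_i <= box`_i & c (mkpart k (g t)) mu sig != 0].
  elim: t => [|t [sig [psg sle nz']]].
    exists box; split=> //; have [p0 n0] := G 0.
    suff -> : mkpart k (g 0) = kap by [].
    by apply: part_ext => // i; rewrite n0 /g subn0; apply/maxn_idPr.
  have [p0 n0] := G t; have [p1 n1] := G t.+1.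
  have vs : vstrip (mkpart k (g t.+1)) (mkpart k (g t)).
    by apply/vstripP => i; rewrite n0 n1 /g; lia.
  have [sig' [ps' /vstripP hs nz1]] := LR_reach_down LRc pieri_vstrip p1 p0 pm psg vs nz'.
  by exists sig'; split=> // i; apply: leq_trans (sle i); case/andP: (hs i).
have [sig [psg sle]] := step l; have [p1 n1] := G l.
have -> : mkpart k (g l) = lam.
  apply: part_ext => // i; rewrite n1 /g; apply/maxn_idPl.
  have : kap`_i <= l by rewrite (leq_trans _ hd) // head_nth0 part_ge.
  by lia.
exists sig; split=> //; first by apply: leq_trans sb; apply: contain_size.
by rewrite head_nth0 (leq_trans (sle 0)) // -head_nth0.
Qed.

End Box.

(** * Rim hooks *)

Section Skew.
Variable rho : seq nat.
Hypothesis pr : is_part rho.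
Implicit Types (nu : seq nat) (R : {set box rho}).

Definition skew nu : {set box rho} := [set x : box rho | nu`_x.1 <= x.2 < rho`_x.1].

Lemma box_exists i j : j < rho`_i -> exists x : box rho, x.1 = i :> nat /\ x.2 = j :> nat.
Proof.
move=> lt; have hi : i < size rho by rewrite -part_nth_gt0 // (leq_ltn_trans _ lt).
have hj : j < head 0 rho by rewrite head_nth0 (leq_trans lt) // part_ge.
by exists (Ordinal hi, Ordinal hj).
Qed.

Lemma box_inj (x y : box rho) : x.1 = y.1 :> nat -> x.2 = y.2 :> nat -> x = y.
Proof. by case: x y => [a b] [a' b'] /= /val_inj -> /val_inj ->. Qed.

Lemma card_skew nu : is_part nu -> (forall i, nu`_i <= rho`_i) ->
  #|skew nu| = sumn rho - sumn nu.
Proof.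
move=> pn le; have sn : size nu <= size rho by apply: contain_size.
rewrite (sumn_nth (leqnn _)) (sumn_nth sn) -sumnB // -sum1_card.
rewrite (eq_bigl (fun x : box rho => true && (nu`_x.1 <= x.2 < rho`_x.1))); last first.
  by move=> x; rewrite inE.
rewrite -(pair_big_dep xpredT (fun (i : 'I_(size rho)) (j : 'I_(head 0 rho)) => nu`_i <= j < rho`_i)
  (fun _ _ => 1)) /=.
apply: eq_bigr => i _.
have le_h : rho`_i <= head 0 rho by rewrite head_nth0 part_ge.
rewrite -(big_mkord (fun j => nu`_i <= j < rho`_i) (fun=> 1)).
rewrite (big_cat_nat (leq0n _) (leq_trans (le i) le_h)) /=.
rewrite big_nat_cond big1 ?add0n; last by move=> j; lia.
rewrite (big_cat_nat (le i) le_h) /= [X in _ + X]big_nat_cond [X in _ + X]big1 ?addn0; last by move=> j; lia.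
by rewrite -big_nat sum_nat_const_nat muln1.
Qed.

Lemma skew_legal nu : is_part nu -> legal (skew nu).
Proof.
move=> pn; apply/forall_inP => b; rewrite !inE => /andP[h1 h2]; apply/forallP => b'.
apply/implyP => /andP[l1 l2]; rewrite !inE.
have b2 : b.2 < nu`_b.1 by move: h1; rewrite h2 andbT -ltnNge.
have e1 : nu`_b.1 <= nu`_b'.1 by apply: part_ge.
have e2 : rho`_b.1 <= rho`_b'.1 by apply: part_ge.
by rewrite leqNgt (leq_ltn_trans l2 (leq_trans b2 e1)) (leq_ltn_trans l2 (leq_trans h2 e2)).
Qed.

(** What remains after a legal removal is closed upwards and to the left, so its rows are initial
    segments of decreasing length. *)
Lemma legal_skew R : R \subset diagram rho -> legal R ->
  [/\ is_part (remove_boxes R), (forall i, (remove_boxes R)`_i <= rho`_i)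
    & R = skew (remove_boxes R)].
Proof.
move=> sub /forall_inP leg; set D := diagram rho :\: R.
have cl (b b' : box rho) : b \in D -> b'.1 <= b.1 -> b'.2 <= b.2 -> b' \in D.
  by move=> bD h1 h2; have /forallP/(_ b')/implyP := leg b bD; apply; rewrite h1 h2.
pose r (i : 'I_(size rho)) := #|[set j | (i, j) \in D]|.
have rP (i : 'I_(size rho)) (j : 'I_(head 0 rho)) : ((i, j) \in D) = (j < r i).
  apply/idP/idP => [h|].
    apply: (@leq_trans #|[set j' : 'I_(head 0 rho) | j' < j.+1]|).
      rewrite cardsE -sum1_card (eq_bigl (fun j' : 'I_(head 0 rho) => j' < j.+1)) //.
      by rewrite -(big_ord_widen _ (fun=> 1)) ?sum1_card ?card_ord.
    apply/subset_leq_card/subsetP => j'; rewrite !inE ltnS => le.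
    by have := cl (i, j) (i, j') h (leqnn _) le; rewrite !inE.
  apply: contraTT => h; rewrite -leqNgt.
  apply: (@leq_trans #|[set j' : 'I_(head 0 rho) | j' < j]|).
    apply/subset_leq_card/subsetP => j' h'; rewrite inE ltnNge; apply: contra h => le.
    by move: h'; rewrite inE => /cl; apply.
  rewrite cardsE -sum1_card (eq_bigl (fun j' : 'I_(head 0 rho) => j' < j)) //.
  by rewrite -(big_ord_widen _ (fun=> 1)) ?sum1_card ?card_ord // ltnW.
have r_mono (i i' : 'I_(size rho)) : i' <= i -> r i <= r i'.
  move=> le; apply/subset_leq_card/subsetP => j; rewrite !inE => h.
  by have := cl (i, j) (i', j); rewrite !inE; apply.
pose g i := if insub i is Some i' then r i' else 0.
have gE (i : 'I_(size rho)) : g i = r i by rewrite /g valK.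
have g0 i : size rho <= i -> g i = 0 by move=> le; rewrite /g insubN // -leqNgt.
have E : remove_boxes R = mkpart (size rho) g.
  rewrite /remove_boxes /mkpart -val_enum_ord -map_comp; congr drop_zeros.
  by apply: eq_map => i /=; rewrite gE.
have [||pt nt st] := @mkpartP (size rho) g.
- move=> i; have [lt|ge] := ltnP i.+1 (size rho); last by rewrite g0.
  by rewrite (gE (Ordinal lt)) (gE (Ordinal (ltnW lt))); apply: r_mono => /=.
- exact: g0.
rewrite E; split=> // [i|].
  have [lt|ge] := ltnP i (size rho); last by rewrite nt g0.
  rewrite nt (gE (Ordinal lt)) leqNgt; apply/negP => h.
  have lth : rho`_i < head 0 rho.
    apply: leq_trans h _; rewrite -[X in _ <= X]card_ord; exact: max_card.
  have := rP (Ordinal lt) (Ordinal lth); rewrite /= h !inE /= ltnn andbF; done.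
apply/setP => -[i j]; rewrite inE /= nt gE leqNgt -rP !inE /=.
have := subsetP sub (i, j); rewrite inE /=.
by case: ((i, j) \in R) => /= [->|_] //; rewrite andNb.
Qed.

Variable nu : seq nat.
Hypotheses (pn : is_part nu) (sub : forall i, nu`_i <= rho`_i).

Lemma colen_sub j : colen nu j <= colen rho j.
Proof.
rewrite leqNgt; apply/negP; rewrite colen_gt // => h.
by have := leq_trans h (sub _); rewrite -colen_gt // ltnn.
Qed.

Lemma in_skew (x : box rho) : (x \in skew nu) = (colen nu x.2 <= x.1 < colen rho x.2).
Proof. by rewrite inE leqNgt -!colen_gt // -leqNgt andbC andbC. Qed.

Lemma box_in_skew i j : colen nu j <= i < colen rho j ->
  exists2 x : box rho, x \in skew nu & x.1 = i :> nat /\ x.2 = j :> nat.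
Proof.
move=> /andP[h1 h2]; have [|x [e1 e2]] := @box_exists i j; first by rewrite -colen_gt.
by exists x => //; rewrite in_skew e1 e2 h1.
Qed.

(** Columns [m] and [m.+1] of the skew shape share the rows from [colen nu m] up to, but excluding,
    [colen rho m.+1]; a square needs two shared rows. *)
Lemma skew_2x2 : reflect (forall m, colen rho m.+1 <= (colen nu m).+1) (~~ has_2x2_square (skew nu)).
Proof.
apply: (iffP idP) => [+ m|h].
  apply: contraNleq => lt; have := colen_geS rho m; have := colen_geS nu m => ga gb.
  have [|x xS [e1 e2]] := @box_in_skew (colen nu m) m; first by lia.
  have [|y yS [f1 f2]] := @box_in_skew (colen nu m).+1 m.+1; first by lia.
  apply/exists_inP; exists x => //; apply/exists_inP; exists y => //.
  rewrite f1 e1 f2 e2 !eqxx !in_skew /= f1 f2 e1 e2; lia.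
apply/negP => /exists_inP[x + /exists_inP[y]]; rewrite !in_skew => /andP[h1 h2] /andP[h3 h4].
move=> /and4P[/eqP e1 /eqP e2 _ _]; have := h x.2; rewrite -e2 => h5.
by move: (leq_trans h4 h5); rewrite e1 ltnS ltnNge h1.
Qed.

Let conn := [rel u v : box rho | [&& u \in skew nu, v \in skew nu & adjacent u v]].

Lemma adjacent_sym (x y : box rho) : adjacent x y = adjacent y x.
Proof.
by rewrite /adjacent [y.1 == x.1]eq_sym [y.2 == x.2]eq_sym; congr ((_ && _) || (_ && _)); rewrite orbC.
Qed.

(** If columns [m] and [m.+1] shared no row, no adjacency could cross between them, and the boxes in
    columns up to [m] would be cut off from the others. *)
Lemma skew_connected_cut j1 j2 m : connected_boxes (skew nu) ->
  colen nu j1 < colen rho j1 -> colen nu j2 < colen rho j2 -> j1 <= m < j2 ->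
  colen nu m < colen rho m.+1.
Proof.
move=> /forall_inP cn n1 n2 /andP[jm mj].
have [|x xS [x1 x2]] := @box_in_skew (colen nu j1) j1; first by rewrite leqnn.
have [|y yS [y1 y2]] := @box_in_skew (colen nu j2) j2; first by rewrite leqnn.
have /forall_inP/(_ y yS) co := cn x xS.
rewrite ltnNge; apply/negP => ge.
have cl : closed conn [pred u : box rho | u.2 <= m].
  move=> u v /and3P[uS vS ad]; rewrite !inE.
  move: uS vS; rewrite !in_skew => /andP[u1 u2] /andP[v1 v2].
  have key (w w' : box rho) : w.1 = w'.1 :> nat -> w.2.+1 = w'.2 ->
      colen nu w.2 <= w.1 -> w'.1 < colen rho w'.2 -> (w.2 <= m) = (w'.2 <= m).
    move=> e1 e2 h1 h2; rewrite -e2; apply/idP/idP => [le|]; last exact: ltnW.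
    rewrite ltn_neqAle le andbT; apply/eqP => em; rewrite -e2 em -e1 in h2.
    by rewrite em in h1; lia.
  case/orP: ad => /andP[/eqP e1 /orP[]/eqP e2].
  - by apply: key => //; rewrite e1.
  - by apply/esym/key => //; rewrite e1.
  - by rewrite e1.
  by rewrite e1.
have := closed_connect cl co; rewrite !inE x2 y2 jm; lia.
Qed.

Lemma skew_connected c d : colen nu d < colen rho d ->
  (forall m, c <= m < d -> colen nu m < colen rho m.+1) ->
  (forall m, (m < c) || (d < m) -> colen nu m = colen rho m) ->
  connected_boxes (skew nu).
Proof.
move=> nd ov out.
have [|t tS [t1 t2]] := @box_in_skew (colen nu d) d; first by rewrite leqnn.
have inR (u : box rho) : u \in skew nu -> c <= u.2 <= d.
  rewrite in_skew => h; apply: contraTT h => h; rewrite (out u.2); last by lia.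
  by lia.
have cs : connect_sym conn.
  apply: sym_connect_sym => x y /=; rewrite adjacent_sym andbA [(x \in _) && _]andbC -andbA; done.
(* Climb to the top of the column, then step right along a shared row. Either move lowers the
   measure, and the walk ends at [t], the top box of the last column [d]. *)
have toT N (u : box rho) : u \in skew nu -> u.1 + (d - u.2) < N -> connect conn u t.
  elim: N u => // N IH u uS; rewrite ltnS => le.
  have /andP[u2c u2d] := inR u uS; have := uS; rewrite in_skew => /andP[h1 h2].
  have [lt|ge] := ltnP (colen nu u.2) u.1.
    have [|v vS [v1 v2]] := @box_in_skew u.1.-1 u.2; first by lia.
    apply: connect_trans (IH v vS _); last by rewrite v1 v2; lia.
    apply: connect1; rewrite /= uS vS /adjacent; apply/orP; right.
    by rewrite -val_eqE /= v2 v1 eqxx /=; lia.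
  have [ltd|ged] := ltnP u.2 d; last first.
    have e2 : u.2 = d :> nat by lia.
    have e1 : u.1 = colen nu d :> nat by rewrite -e2; lia.
    have -> : u = t by apply: box_inj; rewrite ?t1 ?t2.
    exact: connect0.
  have lt := ov u.2; have [|v vS [v1 v2]] := @box_in_skew u.1 u.2.+1.
    by have := colen_geS nu u.2; lia.
  apply: connect_trans (IH v vS _); last by rewrite v1 v2; lia.
  apply: connect1; rewrite /= uS vS /adjacent; apply/orP; left.
  by rewrite -val_eqE /= v1 v2 !eqxx.
apply/forall_inP => x xS; apply/forall_inP => y yS.
by apply: connect_trans (toT _ _ xS (leqnn _)) _; rewrite cs; apply: toT yS (leqnn _).
Qed.

Lemma width_skew c d : c <= d < head 0 rho ->
  (forall m, (colen nu m < colen rho m) = (c <= m <= d)) -> width (skew nu) = (d - c).+1.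
Proof.
move=> /andP[cd dh] ne; rewrite /width.
have -> : [set x.2 | x : box rho in skew nu] = [set j : 'I_(head 0 rho) | c <= j < d.+1].
  apply/setP => j; rewrite inE ltnS -ne; apply/imsetP/idP => [[x + ->]|h].
    by rewrite in_skew => /andP[]; apply: leq_ltn_trans.
  have [|x xS [_ x2]] := @box_in_skew (colen nu j) j; first by rewrite leqnn.
  by exists x => //; apply: val_inj.
rewrite -sum1dep_card -(big_mkord (fun j => c <= j < d.+1) (fun=> 1)).
have cd1 : c <= d.+1 by lia.
rewrite (big_cat_nat (leq0n c)) /=; last by lia.
rewrite big_nat_cond big1 ?add0n; last by move=> j; lia.
rewrite (big_cat_nat cd1 dh) /= [X in _ + X]big_nat_cond [X in _ + X]big1 ?addn0; last by move=> j; lia.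
by rewrite -big_nat sum_nat_const_nat muln1; lia.
Qed.

End Skew.

(** With the column lengths of [nu] and [rho] for [a] and [b], this converts the difference of sizes
    into the length of the bead's jump. *)
Lemma sum_shift (a b : nat -> nat) c d K : c <= d < K ->
  (forall m, c <= m < d -> b m.+1 = (a m).+1) ->
  (forall m, (m < c) || (d < m) -> a m = b m) ->
  \sum_(m < K) b m + a d = \sum_(m < K) a m + (b c + (d - c)).
Proof.
move=> /andP[cd dK] sh out; rewrite -!(big_mkord xpredT).
have cK : c <= K by lia.
rewrite !(big_cat_nat (leq0n c) cK) /=.
have cd1 : c <= d.+1 by lia.
rewrite !(big_cat_nat cd1 dK) /=.
have -> : \sum_(0 <= i < c) a i = \sum_(0 <= i < c) b i.
  by apply: eq_big_nat => i h; apply: out; lia.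
have -> : \sum_(d.+1 <= i < K) a i = \sum_(d.+1 <= i < K) b i.
  by apply: eq_big_nat => i h; apply: out; lia.
rewrite [\sum_(c <= i < d.+1) a i]big_nat_recr //= big_nat_recl //.
have -> : \sum_(c <= i < d) b i.+1 = \sum_(c <= i < d) a i + (d - c).
  rewrite (eq_big_nat _ _ (F2 := fun i => a i + 1)); last by move=> i h; rewrite sh // addn1.
  by rewrite big_split /= sum_nat_const_nat muln1.
lia.
Qed.

(* In terms of the beads [colen rho m + (k - m.+1)], [m < k], the bead at [c]
   jumps down by [n] over the beads [c + 1], ..., [d], and [w] is one more than
   their number. *)
Definition bead_move (n : nat) (rho nu : seq nat) (w : nat) : Prop :=
  exists c d, [/\ (c <= d) && (colen nu d < colen rho d), w = (d - c).+1,
    forall m, c <= m < d -> colen rho m.+1 = (colen nu m).+1,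
    forall m, (m < c) || (d < m) -> colen nu m = colen rho m
    & colen nu d + n = colen rho c + (d - c)].

(** Take for [c] and [d] the first and last columns of the hook. Connectedness and the absence of
    squares bound the overlap of neighbouring columns from below and above, so it is exactly one
    row. *)
Lemma rim_hook_bead_move n rho (R : {set box rho}) : is_part rho -> 0 < n ->
  rim_hook n R -> legal R ->
  [/\ is_part (remove_boxes R), forall i, (remove_boxes R)`_i <= rho`_i,
      sumn rho = sumn (remove_boxes R) + n & bead_move n rho (remove_boxes R) (width R)].
Proof.
move=> pr n0 /and4P[sD /eqP card cn sq] leg; have [pn sub eR] := legal_skew sD leg.
set nu := remove_boxes R in pn sub eR *.
have le := sumn_le sub.
have sz : sumn rho = sumn nu + n.
  by have := card_skew pr pn sub; rewrite -eR card; lia.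
split=> //; move: cn sq; rewrite eR => cn /(skew_2x2 pr pn) sq.
have nuh : head 0 nu <= head 0 rho by rewrite !head_nth0.
have exj : exists j, colen nu j < colen rho j.
  have [/existsP[j h]|] := boolP [exists j : 'I_(head 0 rho), colen nu j < colen rho j]; first by exists j.
  rewrite negb_exists => /forallP h; exfalso.
  move: sz; rewrite (sumn_colen pr (leqnn _)) (sumn_colen pn nuh).
  suff -> : \sum_(j < head 0 rho) colen rho j = \sum_(j < head 0 rho) colen nu j by lia.
  by apply: eq_bigr => j _; apply/eqP; rewrite eqn_leq leqNgt h colen_sub.
have bd j : colen nu j < colen rho j -> j <= head 0 rho.
  by move=> h; rewrite ltnW // -colen_head // (leq_ltn_trans _ h).
pose c := ex_minn exj; pose d := ex_maxn exj bd.
have [nc minc] : colen nu c < colen rho c /\ forall j, colen nu j < colen rho j -> c <= j.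
  by rewrite /c; case: ex_minnP.
have [nd maxd] : colen nu d < colen rho d /\ forall j, colen nu j < colen rho j -> j <= d.
  by rewrite /d; case: ex_maxnP.
have cd : c <= d by apply: minc.
have dh : d < head 0 rho by rewrite -colen_head // (leq_ltn_trans _ nd).
have sh m : c <= m < d -> colen rho m.+1 = (colen nu m).+1.
  by move=> h; have := skew_connected_cut pr pn cn nc nd h; have := sq m; lia.
have out m : (m < c) || (d < m) -> colen nu m = colen rho m.
  move=> h; apply/eqP; rewrite eqn_leq colen_sub //= leqNgt; apply/negP => lt.
  by have := minc m lt; have := maxd m lt; lia.
exists c, d; split=> //; first by rewrite cd.
  apply: width_skew => //; first by rewrite cd.
  move=> m; apply/idP/idP => [h|h]; first by rewrite minc ?maxd.
  have [->//|ne] := eqVneq m d.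
  by have := sh m; have := colen_geS rho m; lia.
have := @sum_shift _ _ c d (head 0 rho) _ sh out; rewrite cd dh => /(_ isT).
by rewrite -(sumn_colen pr (leqnn _)) -(sumn_colen pn nuh) sz; lia.
Qed.

Lemma bead_move_rim_hook n rho nu w : is_part rho -> is_part nu ->
  (forall i, nu`_i <= rho`_i) -> sumn rho = sumn nu + n -> bead_move n rho nu w ->
  exists R : {set box rho}, rim_hook n R && legal R.
Proof.
move=> pr pn sub sz [c [d [/andP[cd nd] _ sh out e]]]; exists (@skew rho nu).
rewrite skew_legal // andbT; apply/and4P; split.
- by apply/subsetP => x; rewrite !inE => /andP[].
- by rewrite card_skew // sz addKn.
- by apply: (skew_connected pr pn nd) out => m /sh ->.
apply/(skew_2x2 pr pn) => m; have [/sh -> //|h] := boolP (c <= m < d).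
have [mo|mo] := boolP ((m < c) || (d < m)); first by rewrite (out m mo) leqW ?colen_geS.
have -> : m = d by lia.
by rewrite -(out d.+1) ?ltnSn ?orbT // leqW ?colen_geS.
Qed.

(** * Beads *)

Definition bead (k : nat) (rho : seq nat) (m : nat) : nat := colen rho m + (k - m.+1).

Lemma bead_decr k rho i j : i < j < k -> bead k rho j < bead k rho i.
Proof. by move=> h; have := @colen_ge rho i j; rewrite /bead; lia. Qed.

(** The sequence [f] with its entry at [c] moved to place [d] and those in between moved up by one
    place: the reordering of beads caused by a jump. *)
Definition cycle_row (f : nat -> nat) (c d m : nat) : nat :=
  if (m < c) || (d < m) then f m else if m < d then f m.+1 else f c.

Lemma cycle_row_perm k c d : c <= d < k -> exists s : 'S_k,
  (forall f (i : 'I_k), cycle_row f c d i = f (s i)) /\ (s : bool) = odd (d - c).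
Proof.
move=> /andP[cd]; rewrite -(subnKC cd) addKn; elim: (d - c) => [|t IH] lt.
  exists 1%g; split=> [f i|]; last by rewrite odd_perm1.
  by rewrite perm1 /cycle_row addn0; case: ltngtP => //= ->.
have [s [es os]] := IH ltac:(lia).
have lt0 : c + t < k by lia.
have lt1 : (c + t).+1 < k by lia.
exists (tperm (Ordinal lt0) (Ordinal lt1) * s)%g; split=> [f i|]; last first.
  by rewrite odd_permM odd_tperm os -val_eqE /= neq_ltn ltnSn.
rewrite permM -es /cycle_row addnS; case: tpermP => [->|->|/eqP h1 /eqP h2] /=.
- by do !case: ifP; lia.
- by do !case: ifP; lia.
move: h1 h2; rewrite -!val_eqE /= => h1 h2.
by do !case: ifP; lia.
Qed.

Section Beads.
Variables (k n : nat).

Lemma bead_move_cycle rho nu w : is_part rho -> head 0 rho <= k -> bead_move n rho nu w ->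
  exists c d, [/\ c <= d < k, w = (d - c).+1, n <= bead k rho c,
    forall m, m < k -> m != d -> bead k nu m = cycle_row (bead k rho) c d m
    & bead k nu d = bead k rho c - n].
Proof.
move=> pr hr [c [d [/andP[cd nd] ew sh out e]]].
have dk : d < k by apply: leq_trans hr; rewrite -colen_head // (leq_ltn_trans _ nd).
exists c, d; split=> //; rewrite ?cd // /bead; [lia| |lia].
move=> m mk md; rewrite /cycle_row; case: ifP => [/out -> //|h].
have h' : c <= m < d by lia.
by have /andP[_ ->] := h'; have := sh m h'; lia.
Qed.

Section Alt.
Import GRing.Theory.
Local Open Scope ring_scope.

(** Lowering an exponent by [n] is invisible at [n]-th roots of unity, and reordering costs the sign
    of a cycle of length [w]. That sign is split into the factor of [hook_sign] and the value of
    [q]. *)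
Lemma bead_move_alt (R : comNzRingType) (y : 'I_k -> R) rho nu w :
  is_part rho -> (head 0 rho <= k)%N -> (forall j, y j ^+ n = 1) -> bead_move n rho nu w ->
  alt y (bead k rho) = (-1) ^+ (k - w) * (-1) ^+ k.-1 * alt y (bead k nu).
Proof.
move=> pr hr yn /(bead_move_cycle pr hr)[c [d [/andP[cd dk] -> nc out e]]].
have [|s [es os]] := @cycle_row_perm k c d; first by rewrite cd.
have -> : alt y (bead k nu) = (-1) ^+ s * alt y (bead k rho).
  rewrite -alt_perm; congr (\det _); apply/matrixP => i j; rewrite !mxE /= -es.
  have [ed|ne] := eqVneq (i : nat) d; last by rewrite out ?ltn_ord.
  rewrite ed e /cycle_row ltnn ltnNge cd /= -[RHS](congr1 (fun m => y j ^+ m) (subnK nc)).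
  by rewrite exprD yn mulr1.
rewrite !mulrA os signr_odd -!exprD -signr_odd (_ : odd _ = false) ?expr0 ?mul1r //.
lia.
Qed.

End Alt.

Definition big_beads (rho : seq nat) : nat := \sum_(i < k) (n <= bead k rho i).

Lemma bead_move_big rho nu w : is_part rho -> head 0 rho <= k ->
  bead_move n rho nu w -> big_beads rho <= (big_beads nu).+1.
Proof.
move=> pr hr /(bead_move_cycle pr hr)[c [d [/andP[cd dk] _ nc out e]]].
have [|s [es _]] := @cycle_row_perm k c d; first by rewrite cd.
rewrite /big_beads (reindex_inj (@perm_inj _ s)) /=.
rewrite (bigD1 (Ordinal dk)) //= [X in _ <= X.+1](bigD1 (Ordinal dk)) //=.
rewrite (eq_bigr (fun i : 'I_k => (n <= bead k nu i : nat))).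
  by rewrite -addSn leq_add2r; case: (n <= _).
by move=> i; rewrite -val_eqE /= => ne; rewrite out // es.
Qed.

(** The bead at [c] can jump to a vacant place [x]. It passes every later bead above [x], the last
    of which is [d]; [a] lists the column lengths after the jump. *)
Lemma movable_rim_hook rho c : is_part rho -> head 0 rho <= k -> 0 < n -> c < k ->
  n <= bead k rho c -> (forall j, j < k -> bead k rho j != bead k rho c - n) ->
  exists R : {set box rho}, rim_hook n R && legal R.
Proof.
move=> pr hr n0 ck nc free; set x := bead k rho c - n in free.
have exd : exists j, (j < k) && (x < bead k rho j) by exists c; rewrite ck /x; lia.
have bdd j : (j < k) && (x < bead k rho j) -> j <= k by lia.
pose d := ex_maxn exd bdd.
have [dk xd maxd] : [/\ d < k, x < bead k rho d & forall j, j < k -> x < bead k rho j -> j <= d].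
  by rewrite /d; case: ex_maxnP => j /andP[h1 h2] h; split=> // i i1 i2; apply: h; rewrite i1.
have cd : c <= d by apply: maxd => //; rewrite /x; lia.
have after j : d < j < k -> bead k rho j < x.
  move=> /andP[dj jk]; rewrite ltn_neqAle free // leqNgt; apply/negP => h.
  by have := maxd j jk h; lia.
(* The [k - d.+1] beads after [d] are distinct and below [x], so the new column length at [d] is not
   truncated. *)
have low : k - d.+1 <= x.
  have [lt|] := ltnP d.+1 k; last by lia.
  by have := after d.+1; rewrite ltnSn lt /bead => /(_ isT); lia.
pose a m := if c <= m < d then (colen rho m.+1).-1
  else if m == d then x - (k - d.+1) else colen rho m.
have ad : a d = x - (k - d.+1) by rewrite /a ltnn andbF eqxx.
have ash m : c <= m < d -> a m = (colen rho m.+1).-1 by rewrite /a => ->.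
have aout m : (m < c) || (d < m) -> a m = colen rho m.
  by move=> h; rewrite /a; case: ifP => [|_]; [lia|case: eqP => //; lia].
have cd0 : x - (k - d.+1) < colen rho d by move: xd; rewrite /bead; lia.
have xc : x + n = colen rho c + (k - c.+1) by rewrite /x subnK.
have mono m : m.+1 < k -> a m.+1 <= a m.
  move=> mk; have g1 := colen_geS rho m; have g2 := colen_geS rho m.+1.
  have [h|h] := boolP ((m < c) || (d < m)).
    rewrite (aout m h); have [h'|h'] := boolP ((m.+1 < c) || (d < m.+1)); first by rewrite aout.
    have [h2|h2] := boolP (c <= m.+1 < d); first by rewrite ash //; lia.
    have e1 : m.+1 = d by lia. have e2 : c = d by lia.
    by rewrite e1 ad; rewrite e2 in xc; rewrite e1 in g1; lia.
  have [h1|h1] := boolP (c <= m < d).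
    rewrite (ash m h1); have [h2|h2] := boolP (c <= m.+1 < d); first by rewrite ash //; lia.
    have e1 : m.+1 = d by lia.
    by rewrite e1 ad; lia.
  have e1 : m = d by lia.
  rewrite e1 in mk *; rewrite ad aout; last by rewrite ltnSn orbT.
  by have := after d.+1; rewrite ltnSn mk /bead => /(_ isT); lia.
have [t [pt st tE]] : exists t, [/\ is_part t, size t <= k & forall i : 'I_k, t`_i = a i].
  by apply: (@fun_part _ (fun i => a i)) => i j e; rewrite -e; apply: mono; rewrite e.
have pc := conjp_part pt.
have colE m : colen (conjp t) m = a m.
  rewrite -nth_conjp // conjpK //; have [lt|ge] := ltnP m k; first by rewrite (tE (Ordinal lt)).
  rewrite nth_default ?(leq_trans st) // aout ?colen_out ?(leq_trans hr) //.
  by rewrite orbC (leq_trans dk).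
have le m : a m <= colen rho m.
  have [h|h] := boolP ((m < c) || (d < m)); first by rewrite aout.
  have [h1|h1] := boolP (c <= m < d); first by rewrite ash //; have := colen_geS rho m; lia.
  by have -> : m = d by [lia]; rewrite ad ltnW.
have hc : head 0 (conjp t) <= k by rewrite head_conjp.
have sh m : c <= m < d -> colen rho m.+1 = (a m).+1.
  move=> h; rewrite ash // prednK //; have : colen rho d <= colen rho m.+1 by apply: colen_ge; lia.
  lia.
apply: (@bead_move_rim_hook n rho (conjp t) (d - c).+1) => //.
- move=> i; rewrite leqNgt; apply/negP; rewrite -colen_gt // => h.
  have := leq_trans h (eq_leq (colE _)) => h2; have := leq_trans h2 (le _).
  by rewrite colen_gt // ltnn.
- rewrite (sumn_colen pr hr) (sumn_colen pc hc).
  have := @sum_shift a (colen rho) c d k _ sh aout; rewrite cd dk => /(_ isT).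
  rewrite [in X in _ -> X](eq_bigr (fun m : 'I_k => a m) (fun m _ => colE m)) ad.
  have : colen rho c + (d - c) = x - (k - d.+1) + n by lia.
  have aux (S S' u v : nat) : v = u + n -> S + u = S' + v -> S = S' + n by lia.
  exact: aux.
exists c, d; split=> //; rewrite ?colE ?cd ?ad //.
- by move=> m h; rewrite colE; apply: sh.
- by move=> m h; rewrite colE; apply: aout.
by move: xc low; lia.
Qed.

End Beads.

(** * Cores *)

Section Core.
Import GRing.Theory.
Local Open Scope ring_scope.

(** These invariants hold whichever hooks [pick] selects. Each removal lowers the size by [n > 0],
    so with fuel at least the size the process stops only when no legal hook is left. *)
Lemma remove_rim_hooksP k n fuel rho : (0 < n)%N -> is_part rho -> (head 0 rho <= k)%N ->
  (sumn rho <= fuel)%N ->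
  let res := remove_rim_hooks fuel n rho in
  [/\ is_part res.1, (head 0 res.1 <= k)%N, sumn rho = (sumn res.1 + size res.2 * n)%N,
    (forall R : {set box res.1}, ~~ (rim_hook n R && legal R)) &
    (big_beads k n rho <= big_beads k n res.1 + size res.2)%N /\
    forall (R : comNzRingType) (y : 'I_k -> R), (forall j, y j ^+ n = 1) ->
      alt y (bead k rho) = (-1) ^+ (\sum_(w <- res.2) (k - w))%N *
        (-1) ^+ (size res.2 * k.-1) * alt y (bead k res.1)].
Proof.
move=> n0; elim: fuel rho => [|fuel IH] rho pr hr sz /=.
  split=> //; [by rewrite addn0| |].
    move=> R; apply/negP => /andP[h1 h2].
    by have [_ _ e _] := rim_hook_bead_move pr n0 h1 h2; move: sz e n0; lia.
  by split=> [|R y _]; rewrite ?addn0 // big_nil !expr0 !mul1r.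
case: pickP => [R /andP[h1 h2]|none] /=; last first.
  split=> //; [by rewrite addn0|by move=> R; rewrite none|].
  by split=> [|R y _]; rewrite ?addn0 // big_nil !expr0 !mul1r.
have [pn le e mv] := rim_hook_bead_move pr n0 h1 h2.
have hn : (head 0 (remove_boxes R) <= k)%N by rewrite head_nth0 (leq_trans (le 0%N)) // -head_nth0.
have [|p h s nr [b a]] := IH (remove_boxes R) pn hn; first by move: sz e n0; lia.
split=> //; first by rewrite e s mulSn; lia.
split=> [|S y yn]; first by have := bead_move_big pr hr mv; move: b; lia.
rewrite (bead_move_alt pr hr yn mv) (a S y yn) big_cons mulSn !exprD !mulrA.
by congr (_ * _); rewrite -!mulrA; congr (_ * _); rewrite mulrCA.
Qed.

Section Fixed.
Variables (l k : nat).
Hypotheses (l0 : (0 < l)%N) (k0 : (0 < k)%N).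
Local Notation n := (l + k)%N.

Let n0 : (0 < n)%N. Proof. by rewrite addn_gt0 l0. Qed.

Lemma bead_lt_rect nu : is_part nu -> (head 0 nu <= k)%N ->
  in_rect l k nu = (bead k nu 0 < n)%N.
Proof.
move=> pn hn; rewrite /in_rect pn hn andbT /= /bead.
have -> : colen nu 0 = size nu by rewrite -nth_conjp // -head_nth0 head_conjp.
by lia.
Qed.

Lemma big_beads_rect nu : in_rect l k nu -> big_beads k n nu = 0%N.
Proof.
move=> h; have /and3P[pn _ hn] := h; rewrite bead_lt_rect // in h.
apply: big1 => i _; apply/eqP; rewrite eqb0 -ltnNge.
have [->//|i0] := posnP i; apply: ltn_trans h; apply: bead_decr; rewrite i0 /=; exact: ltn_ord.
Qed.

Variable rho : seq nat.
Hypotheses (pr : is_part rho) (hr : (head 0 rho <= k)%N).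

Lemma core_part : is_part (core n rho).
Proof. by have [] := remove_rim_hooksP n0 pr hr (leqnn _). Qed.

Lemma core_head : (head 0 (core n rho) <= k)%N.
Proof. by have [] := remove_rim_hooksP n0 pr hr (leqnn _). Qed.

Lemma size_hook_widths : size (hook_widths n rho) = r_ n rho.
Proof.
have [_ _ e _ _] := remove_rim_hooksP n0 pr hr (leqnn _).
have e' : sumn rho = (sumn (core n rho) + size (hook_widths n rho) * n)%N := e.
by rewrite /r_ e' addKn mulnK.
Qed.

Lemma sumn_core : sumn rho = (sumn (core n rho) + r_ n rho * n)%N.
Proof.
by have [_ _ e _ _] := remove_rim_hooksP n0 pr hr (leqnn _); rewrite -size_hook_widths.
Qed.

Lemma big_beads_core : (big_beads k n rho <= big_beads k n (core n rho) + r_ n rho)%N.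
Proof.
by have [_ _ _ _ [h _]] := remove_rim_hooksP n0 pr hr (leqnn _); rewrite -size_hook_widths.
Qed.

(** If the core leaves the rectangle, its largest bead is at least [n]. As no hook can be removed,
    the place [n] lower is occupied, and at [n]-th roots of unity two rows of the determinant
    agree. *)
Lemma alt_core (R : comNzRingType) (y : 'I_k -> R) : (forall j, y j ^+ n = 1) ->
  alt y (bead k rho) = if in_rect l k (core n rho)
    then (hook_sign k n rho)%:~R * (-1) ^+ (r_ n rho * k.-1) * alt y (bead k (core n rho)) else 0.
Proof.
move=> yn; have [_ _ _ nr [_ h]] := remove_rim_hooksP n0 pr hr (leqnn _).
rewrite (h R y yn) -/(core n rho) -/(hook_widths n rho) size_hook_widths.
case: ifP => [_|nrect]; first by rewrite /hook_sign rmorphXn rmorphN1.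
suff -> : alt y (bead k (core n rho)) = 0 by rewrite mulr0.
move/negbT: nrect; rewrite (bead_lt_rect core_part core_head) -leqNgt => ge.
have [/existsP[j /eqP ej]|] := boolP [exists j : 'I_k, bead k (core n rho) j == bead k (core n rho) 0 - n]%N.
  have ne : Ordinal k0 != j.
    by apply/eqP => e; move: ej; rewrite -e /=; move: ge n0; lia.
  have -> : alt y (bead k (core n rho)) = alt y (fun i => if i == j then bead k (core n rho) 0 else bead k (core n rho) i).
    congr (\det _); apply/matrixP => i i'; rewrite !mxE; case: eqP => [->|//].
    by rewrite ej -[in RHS](subnK ge) exprD yn mulr1.
  by apply: (@alt_eq0 _ _ _ _ _ _ ne); rewrite /= eqxx (negbTE ne).
rewrite negb_exists => /forallP free.
have [//|R' hR'] := @movable_rim_hook k n (core n rho) 0 core_part core_head n0 k0 ge.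
  by move=> j jk; apply: (free (Ordinal jk)).
by have := nr R'; rewrite -/(core n rho) hR'.
Qed.

End Fixed.
End Core.

(** * Alternants at roots of unity *)

Section Roots.
Import GRing.Theory Num.Theory.
Local Open Scope ring_scope.

Lemma geom_root n (z : algC) e : n.-primitive_root z ->
  \sum_(i < n) (z ^+ e) ^+ i = if (n %| e)%N then n%:R else 0.
Proof.
move=> pz; rewrite (prim_order_dvd pz); case: eqP => [->|/eqP ne].
  by rewrite (eq_bigr (fun=> 1)) ?sumr_const ?card_ord // => i _; rewrite expr1n.
have : (z ^+ e - 1) * \sum_(i < n) (z ^+ e) ^+ i = 0.
  by rewrite -subrX1 -exprM mulnC exprM (prim_expr_order pz) expr1n subrr.
by move/eqP; rewrite mulf_eq0 subr_eq0 (negbTE ne) => /eqP.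
Qed.

(** Orthogonality of characters on [k]-tuples of [n]-th roots of unity; [n - b' j] plays the part of
    the exponent [- b' j]. *)
Lemma alt_dft k n (z : algC) (b b' : 'I_k -> nat) : n.-primitive_root z ->
  sdecr b -> sdecr b' -> (forall i, b i < n)%N -> (forall i, b' i < n)%N ->
  \sum_(m : {ffun 'I_k -> 'I_n})
     (\prod_j z ^+ (m j * (n - b' j))) * alt (fun j => z ^+ m j) b =
  if [forall i, b i == b' i] then n%:R ^+ k else 0.
Proof.
move=> pz db db' ltb ltb'.
under eq_bigr => m _ do rewrite altE mulr_sumr.
rewrite exchange_big /=.
have E (s : 'S_k) : \sum_(m : {ffun 'I_k -> 'I_n})
     (\prod_j z ^+ (m j * (n - b' j))) * ((-1) ^+ s * \prod_i (z ^+ m (s i)) ^+ b i) =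
   (-1) ^+ s * (if [forall i, b i == b' (s i)] then n%:R ^+ k else 0).
  rewrite (eq_bigr (fun m : {ffun 'I_k -> 'I_n} => (-1) ^+ s *
    \prod_j (z ^+ ((n - b' j) + b (s^-1 j)%g)) ^+ m j)); last first.
    move=> m _; rewrite mulrCA; congr (_ * _).
    rewrite [X in _ * X](reindex_inj (@perm_inj _ (s^-1)%g)) -big_split /=.
    by apply: eq_bigr => j _; rewrite permKV -!exprM -exprD; congr (z ^+ _); lia.
  rewrite -mulr_sumr -(bigA_distr_bigA (fun j (i : 'I_n) =>
    (z ^+ ((n - b' j) + b (s^-1 j)%g)) ^+ i)); congr (_ * _).
  rewrite (eq_bigr _ (fun j _ => geom_root _ pz)).
  (* The sum lies strictly between 0 and [n + n], so [n] is its only admissible multiple. *)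
  have dv (j : 'I_k) : (n %| (n - b' j) + b (s^-1 j)%g)%N = (b (s^-1 j)%g == b' j).
    have h1 := ltb (s^-1 j)%g; have h2 := ltb' j.
    apply/idP/eqP => [/dvdnP[q e]|->]; last by rewrite subnK // ltnW.
    have q1 : q = 1%N by case: q e => [|[|q]] //; rewrite ?mul0n ?mulSn; lia.
    by move: e; rewrite q1 mul1n; lia.
  case: forallP => [h|h].
    rewrite (eq_bigr (fun=> n%:R)) ?prodr_const ?card_ord // => j _.
    by rewrite dv; have := h (s^-1 j)%g; rewrite permKV => ->.
  have [j hj] : exists j, b j != b' (s j).
    by apply/existsP; rewrite -negb_forall; apply/negP => /forallP.
  by rewrite (bigD1 (s j)) //= dv permK (negbTE hj) mul0r.
rewrite (eq_bigr _ (fun s _ => E s)) (bigD1 1%g) //= odd_perm1 expr0 mul1r.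
rewrite big1 ?addr0; last first.
  move=> s; case: forallP => [h ne|_ _]; last by rewrite mulr0.
  by rewrite (sdecr_perm db db' (s := s)) ?eqxx // in ne; move=> i; rewrite (eqP (h i)).
by rewrite (eq_forallb (fun i => _ : _ = (b i == b' i))) // => i; rewrite perm1.
Qed.

Lemma alt_delta_neq0 (F : fieldType) k (y : 'I_k -> F) : injective y ->
  alt y (bead k [::]) != 0.
Proof.
move=> iy; have -> : alt y (bead k [::]) = (-1) ^+ perm (@rev_ord_inj k) * alt y (fun i => i).
  by rewrite -alt_perm; apply: eq_alt => // i; rewrite /= permE /bead /= add0n.
rewrite mulf_neq0 ?signr_eq0 //.
have -> : alt y (fun i => i) = \det (Vandermonde k (\row_j y j)).
  by congr (\det _); apply/matrixP => i j; rewrite !mxE.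
rewrite det_Vandermonde; apply/prodf_neq0 => i _; apply/prodf_neq0 => j lt.
rewrite !mxE subr_eq0; apply: contraTneq lt => /iy->; by rewrite ltnn.
Qed.

(** A vanishing Vandermonde determinant forces two equal variables, which kills every alternant. So
    the Vandermonde factor of a product identity can be cancelled at every point. *)
Lemma alt_delta0 (F : fieldType) k (y : 'I_k -> F) b :
  alt y (bead k [::]) = 0 -> alt y b = 0.
Proof.
move=> e; have : ~~ injectiveb y.
  by apply/negP => /injectiveP/alt_delta_neq0; rewrite e eqxx.
by case/injectivePn => i [j ne eq]; apply: alt_eq0y ne eq.
Qed.

Lemma bead_sdecr k rho : sdecr (fun i : 'I_k => bead k rho i).
Proof. by move=> i j lt; apply: bead_decr; rewrite lt /=; apply: ltn_ord. Qed.

Lemma bead_inj k s t : is_part s -> is_part t -> (head 0 s <= k)%N -> (head 0 t <= k)%N ->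
  (forall i : 'I_k, bead k s i = bead k t i) -> s = t.
Proof.
move=> ps pt hs ht e; rewrite -(conjpK ps) -(conjpK pt); congr conjp.
apply: part_ext; rewrite ?conjp_part // => i; rewrite !nth_conjp //.
have [lt|ge] := ltnP i k; first by have /addIn := e (Ordinal lt).
by rewrite !colen_out // (leq_trans _ ge).
Qed.

Lemma roots_indep l k (x : seq nat -> int) : (0 < l)%N -> (0 < k)%N ->
  (forall y : 'I_k -> algC, (forall j, y j ^+ (l + k) = 1) ->
     \sum_(nu <- shapes l k) (x nu)%:~R * alt y (bead k nu) = 0) ->
  forall nu, in_rect l k nu -> x nu = 0.
Proof.
move=> l0 k0 h nu0 rnu0; set n := (l + k)%N in h; have n0 : (0 < n)%N by rewrite addn_gt0 k0 orbT.
have [z pz] := C_prim_root_exists n0.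
have lt nu : in_rect l k nu -> forall i : 'I_k, (bead k nu i < n)%N.
  move=> r i; have := big_beads_rect l0 k0 r; move/eqP; rewrite sum_nat_eq0 => /forallP/(_ i).
  by rewrite /= eqb0 -ltnNge.
have : \sum_(m : {ffun 'I_k -> 'I_n}) (\prod_j z ^+ (m j * (n - bead k nu0 j))) *
   \sum_(nu <- shapes l k) (x nu)%:~R * alt (fun j => z ^+ m j) (bead k nu) = 0.
  apply: big1 => m _; rewrite h ?mulr0 // => j.
  by rewrite -exprM mulnC exprM (prim_expr_order pz) expr1n.
under eq_bigr => m _ do rewrite mulr_sumr.
rewrite exchange_big /= (bigD1_seq nu0) ?shapes_uniq ?mem_shapes //=.
have E nu : in_rect l k nu ->
    \sum_(m : {ffun 'I_k -> 'I_n}) (\prod_j z ^+ (m j * (n - bead k nu0 j))) *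
      ((x nu)%:~R * alt (fun j => z ^+ m j) (bead k nu)) =
    (x nu)%:~R * (if nu == nu0 then n%:R ^+ k else 0).
  move=> r; under eq_bigr => m _ do rewrite mulrCA.
  rewrite -mulr_sumr.
  have D := alt_dft pz (@bead_sdecr k nu) (@bead_sdecr k nu0) (lt _ r) (lt _ rnu0).
  apply: etrans (congr1 _ D) _.
  suff -> : [forall i : 'I_k, bead k nu i == bead k nu0 i] = (nu == nu0) by [].
  apply/forallP/eqP => [e|-> i]; last exact: eqxx.
  have /and3P[p1 _ h1] := r; have /and3P[p0 _ h0] := rnu0.
  by apply: (bead_inj p1 p0 h1 h0) => i; apply/eqP.
rewrite (E _ rnu0) eqxx big_seq_cond big1 ?addr0.
  move/eqP; rewrite mulf_eq0 intr_eq0 expf_eq0 pnatr_eq0 => /orP[/eqP//|].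
  by move: n0; case: (n) => // ? _; rewrite andbF.
by move=> nu /andP[]; rewrite mem_shapes => /E-> /negbTE->; rewrite mulr0.
Qed.

End Roots.

(** * The rim hook formula for products of alternants *)

Section Product.
Import GRing.Theory Num.Theory.
Local Open Scope ring_scope.

Variable c : seq nat -> seq nat -> seq nat -> nat.
Hypothesis LRc : LR_coefficients c.
Variables l k : nat.
Hypotheses (l0 : (0 < l)%N) (k0 : (0 < k)%N).
Local Notation n := (l + k)%N.

(* The coefficient of [nu] in the rim hook formula at [q = (-1)^(k-1)]. *)
Definition hook_coeff (lam mu nu : seq nat) : int :=
  \sum_(rho <- partitions_of (sumn lam + sumn mu) | (head 0%N rho <= k)%N && (core n rho == nu))
    hook_sign k n rho * (-1) ^+ (r_ n rho * k.-1) * (c lam mu rho)%:Z.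

Lemma altp_conjp (R : comNzRingType) (y : 'I_k -> R) s : is_part s ->
  altp y (conjp s) = alt y (bead k s).
Proof. by move=> ps; apply: eq_alt => // i; rewrite nth_conjp. Qed.

(** Multiply the alternants of the transposes by the Littlewood-Richardson rule, which [LR_conjp]
    brings back to [c lam mu rho], and reduce each resulting alternant to its core. *)
Lemma alt_product (y : 'I_k -> algC) lam mu : (forall j, y j ^+ n = 1) ->
  in_rect l k lam -> in_rect l k mu ->
  alt y (bead k lam) * alt y (bead k mu) = alt y (bead k [::]) *
    \sum_(nu <- shapes l k) (hook_coeff lam mu nu)%:~R * alt y (bead k nu).
Proof.
move=> yn /and3P[pl _ hl] /and3P[pm _ hm].
rewrite -!altp_conjp // (LR_altp LRc y (conjp_part pl) (conjp_part pm)) ?size_conjp //.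
congr (_ * _); rewrite !sumn_conjp // -(perm_big _ (perm_partitions_conjp _)) /= big_map.
under [RHS]eq_bigr => nu _.
  rewrite /hook_coeff rmorph_sum mulr_suml big_mkcondr /=; over.
rewrite exchange_big /= big_seq_cond [RHS]big_seq_cond.
apply: eq_big => [rho|rho /andP[]]; first by rewrite size_conjp.
rewrite mem_partitions size_conjp => /andP[pr _] hr.
rewrite altp_conjp // (alt_core l0 k0 pr hr yn) LR_conjp //.
case: ifP => [r|nr].
  rewrite (bigD1_seq (core n rho)) ?shapes_uniq ?mem_shapes //= eqxx big1 ?addr0; last first.
    by move=> nu ne; rewrite eq_sym (negbTE ne).
  by rewrite !rmorphM /= !rmorphXn !rmorphN1 -mulrnAl; congr (_ * _); rewrite -mulr_natr.
rewrite mul0rn big_seq_cond big1 // => nu; rewrite mem_shapes andbT => h.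
by case: eqP => // e; rewrite e h in nr.
Qed.

Lemma hook_coeff_eq lam mu lam' mu' (b : bool) :
  in_rect l k lam -> in_rect l k mu -> in_rect l k lam' -> in_rect l k mu' ->
  (forall y : 'I_k -> algC, (forall j, y j ^+ n = 1) ->
     alt y (bead k lam') * alt y (bead k mu') =
     (-1) ^+ b * (alt y (bead k lam) * alt y (bead k mu))) ->
  forall nu, in_rect l k nu -> hook_coeff lam' mu' nu = (-1) ^+ b * hook_coeff lam mu nu.
Proof.
move=> rl rm rl' rm' h nu rnu; apply/eqP; rewrite -subr_eq0; apply/eqP.
apply: (@roots_indep l k (fun nu => hook_coeff lam' mu' nu - (-1) ^+ b * hook_coeff lam mu nu)) => // y yn.
have := h y yn; rewrite !alt_product // mulrCA => /eqP.
rewrite -subr_eq0 -mulrBr mulf_eq0 => /orP[/eqP z|/eqP e].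
  by apply: big1 => nu' _; rewrite (alt_delta0 _ z) mulr0.
rewrite -[RHS]e mulr_sumr -sumrB; apply: eq_bigr => nu' _.
by rewrite rmorphB rmorphM rmorphXn rmorphN1 mulrBl mulrA.
Qed.

End Product.

(** * Rotation *)

Lemma sdecr_bead k (g : 'I_k -> nat) : sdecr g ->
  exists nu, [/\ is_part nu, head 0 nu <= k & forall i : 'I_k, bead k nu i = g i].
Proof.
move=> dg; have low m (i : 'I_k) : i + m = k.-1 -> m <= g i.
  elim: m i => // m IH i e; have lt : i.+1 < k by have := ltn_ord i; lia.
  have := IH (Ordinal lt); have := dg i (Ordinal lt); rewrite /= ltnSn => /(_ isT).
  by move=> h1 h2; have := h2 ltac:(lia); lia.
have [t [pt st tE]] : exists t, [/\ is_part t, size t <= k &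
    forall i : 'I_k, t`_i = g i - (k - i.+1)].
  apply: (@fun_part _ (fun i => g i - (k - i.+1))) => i j e.
  by have := dg i j; have := ltn_ord j; rewrite -e ltnSn; lia.
exists (conjp t); split; first exact: conjp_part.
  by rewrite head_conjp.
move=> i; rewrite /bead -nth_conjp ?conjp_part // conjpK // tE subnK //.
by apply: low; have := ltn_ord i; lia.
Qed.

Lemma sort_sdecr k (f : 'I_k -> nat) : injective f -> exists s : 'S_k, sdecr (f \o s).
Proof.
move=> fi; pose t := [tuple f i | i < k].
have /tuple_permP[s es] : perm_eq (sort geq t) t by rewrite perm_sort.
exists s => i j lt /=.
have nthE (i' : 'I_k) : nth 0 (sort geq t) i' = f (s i').
  by rewrite es -tnth_nth !tnth_mktuple.
rewrite -!nthE.
have so : sorted gtn (sort geq t).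
  by rewrite gtn_sorted_uniq_geq sort_uniq map_inj_uniq ?enum_uniq //= sort_sorted.
have tr : transitive gtn by move=> y x z /= h1 h2; apply: ltn_trans h2 h1.
have sz : size (sort geq t) = k by rewrite size_sort size_tuple.
by apply: (sorted_ltn_nth tr 0 so i j); rewrite ?inE ?sz.
Qed.

Section Rotation.
Variables l k : nat.
Hypotheses (l0 : 0 < l) (k0 : 0 < k).
Local Notation n := (l + k).

Lemma bead_lt lam i : in_rect l k lam -> i < k -> bead k lam i < n.
Proof.
move=> r ik; have := big_beads_rect l0 k0 r; move/eqP; rewrite sum_nat_eq0 => /forallP/(_ (Ordinal ik)).
by rewrite /= eqb0 -ltnNge.
Qed.

Lemma rotate lam t : in_rect l k lam -> exists lam' (s : 'S_k), in_rect l k lam' /\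
  forall i : 'I_k, bead k lam' i = (bead k lam (s i) + t) %% n.
Proof.
move=> r; have n0 : 0 < n by rewrite addn_gt0 l0.
have inj : injective (fun i : 'I_k => (bead k lam i + t) %% n).
  move=> i j /eqP; rewrite eqn_modDr !modn_small ?bead_lt // => /eqP e; apply: val_inj.
  by case: (ltngtP i j) => // lt; have := @bead_decr k lam _ _ (introT andP (conj lt (ltn_ord _))); rewrite e ltnn.
have [s ds] := sort_sdecr inj; have [lam' [pl hl e]] := sdecr_bead ds.
exists lam', s; split=> //.
by rewrite (bead_lt_rect l0 k0 pl hl) (e (Ordinal k0)) /= ltn_mod.
Qed.

Lemma sum_bead lam : is_part lam -> head 0 lam <= k ->
  \sum_(i < k) bead k lam i = sumn lam + \sum_(i < k) (k - i.+1).
Proof. by move=> pl hl; rewrite (sumn_colen pl hl) -big_split. Qed.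

Definition above (lam : seq nat) (x : nat) : nat := \sum_(i < k) (x <= bead k lam i).

Lemma above_le lam x : above lam x <= k.
Proof.
rewrite -[X in _ <= X]card_ord -[X in _ <= X]sum1_card; apply: leq_sum => i _; exact: leq_b1.
Qed.

Lemma sum_lt m : m <= k -> \sum_(i < k) (i < m) = m.
Proof.
move=> mk; rewrite -[RHS]card_ord -[RHS]sum1_card (big_ord_widen _ (fun=> 1) mk) [RHS]big_mkcond.
by apply: eq_bigr => i _; case: ifP.
Qed.

Lemma above_bead lam x i : i < above lam x -> x <= bead k lam i.
Proof.
move=> lt; rewrite leqNgt; apply/negP => h; have ik : i < k := leq_trans lt (above_le _ _).
move: lt; rewrite ltnNge => /negP[]; rewrite -[X in _ <= X](sum_lt (ltnW ik)).
apply: leq_sum => j _; case: (ltnP j i) => [_|ij]; first exact: leq_b1.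
rewrite leqn0 eqb0 -ltnNge; apply: leq_ltn_trans h.
by move: ij; rewrite leq_eqVlt => /orP[/eqP->//|lt]; rewrite ltnW // bead_decr // lt /=.
Qed.

Lemma bead_above lam x i : i < k -> x <= bead k lam i -> i < above lam x.
Proof.
move=> ik h; rewrite -[X in X <= _](sum_lt ik); apply: leq_sum => j _.
case: (ltnP j i.+1) => //; rewrite ltnS leq_eqVlt => /orP[/eqP->|lt]; first by rewrite h.
by rewrite (leq_trans h) // ltnW // bead_decr // lt.
Qed.

Lemma modn_rot b t : b < n -> t <= n -> (b + t) %% n = if b + t < n then b + t else b + t - n.
Proof.
move=> bn tn; case: ltnP => h; first by rewrite modn_small.
by rewrite -{1}(subnK h) modnDr modn_small //; lia.
Qed.

(** The function [f] before [k] is subtracted, so that its values can be compared without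
    truncation. *)
Definition overlap (lam mu : seq nat) (t : nat) : nat := above lam (n - t) + above mu t.

(** An identity for one residue [b] is summed over all beads; the condition [n - t <= b] records
    whether [b] wraps around when shifted by [t]. *)
Lemma rotate_above lam lam' t (s : 'S_k) x y e : in_rect l k lam ->
  (forall i : 'I_k, bead k lam' i = (bead k lam (s i) + t) %% n) ->
  (forall b, b < n -> (x <= (b + t) %% n) + (n - t <= b) = (y <= b) + e) ->
  above lam' x + above lam (n - t) = above lam y + k * e.
Proof.
move=> r h p; have -> : above lam' x = \sum_(i < k) (x <= (bead k lam i + t) %% n).
  by rewrite [RHS](reindex_inj (@perm_inj _ s)); apply: eq_bigr => i _; rewrite h.
rewrite -[X in _ + X * _](card_ord k) -sum_nat_const -!big_split /=.
by apply: eq_bigr => i _; rewrite p // bead_lt.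
Qed.

Lemma rotate_sumn lam lam' t (s : 'S_k) : in_rect l k lam -> in_rect l k lam' -> t <= n ->
  (forall i : 'I_k, bead k lam' i = (bead k lam (s i) + t) %% n) ->
  sumn lam' + n * above lam (n - t) = sumn lam + k * t.
Proof.
move=> r r' tn h; have /and3P[pl _ hl] := r; have /and3P[pl' _ hl'] := r'.
have E : \sum_(i < k) bead k lam' i + n * above lam (n - t) = \sum_(i < k) bead k lam i + k * t.
  have -> : \sum_(i < k) bead k lam' i = \sum_(i < k) (bead k lam i + t) %% n.
    by rewrite [RHS](reindex_inj (@perm_inj _ s)); apply: eq_bigr => i _; rewrite h.
  rewrite /above big_distrr -[X in _ + X * _](card_ord k) -sum_nat_const -!big_split /=.
  apply: eq_bigr => i _; have b := bead_lt r (ltn_ord i); rewrite modn_rot //.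
  by case: ifP => h1; case: leqP => h2; lia.
by move: E; rewrite !sum_bead //; lia.
Qed.

(* The beads of [lam] and [mu] are rotated in opposite directions by a [t] for
   which [overlap] is largest; the overlap of the rotated pair is nowhere
   positive, which says that one fits in the dual of the other. *)
Lemma rotate_pair lam mu t : in_rect l k lam -> in_rect l k mu -> t <= n ->
  (forall u, u <= n -> overlap lam mu u <= overlap lam mu t) ->
  exists lam' mu' (s s' : 'S_k),
    [/\ in_rect l k lam' /\ in_rect l k mu',
     forall i : 'I_k, bead k lam' i = (bead k lam (s i) + t) %% n,
     forall i : 'I_k, bead k mu' i = (bead k mu (s' i) + (n - t)) %% n,
     sumn lam' + sumn mu' + n * (overlap lam mu t - k) = sumn lam + sumn mu
     & forall i, i < k -> colen lam' i + colen mu' (k - i.+1) <= l].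
Proof.
move=> rl rm tn max.
have [lam' [s [rl' h]]] := rotate t rl; have [mu' [s' [rm' h']]] := rotate (n - t) rm.
exists lam', mu', s, s'; split=> //.
(* At 0 every bead of [mu] is counted, so the maximum is at least [k] and the subtraction is
   exact. *)
- have ge : k <= overlap lam mu t.
    apply: leq_trans (max 0 (leq0n _)); rewrite /overlap subn0 /above.
    rewrite [X in _ + X](eq_bigr (fun=> 1)) ?sum1_card ?card_ord ?leq_addl // => i _; lia.
  have := rotate_sumn rl rl' tn h; have := rotate_sumn rm rm' (leq_subr t n) h'.
  by rewrite subKn // mulnBr; move: ge; rewrite /overlap mulnDr; nia.
move=> i ik; rewrite leqNgt; apply/negP => gt.
(* A failure at [i] gives [i.+1] beads of [lam'] that are at least [n - x] and [k - i] beads of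
   [mu'] that are at least [x], so the rotated overlap at [x] exceeds [k]. Rotation back shows that
   the original overlap at [u], which is [x + t] reduced by [n] if necessary, exceeds the maximum by
   the same amount. *)
pose x := n - bead k lam' i.
have bi := bead_lt rl' ik.
have xn : x <= n by rewrite leq_subr.
have a1 : i < above lam' (n - x) by apply: bead_above; rewrite // subKn // ltnW.
have a2 : k - i.+1 < above mu' x.
  by apply: bead_above; rewrite /x /bead; move: bi gt; rewrite /bead; lia.
pose u := if x + t <= n then x + t else x + t - n.
have un : u <= n by rewrite /u; case: ifP; lia.
have := @rotate_above lam lam' t s (n - x) (n - u) (n < x + t) rl h.
have := @rotate_above mu mu' (n - t) s' x u (x + t <= n) rm h'.
rewrite subKn // => H2 H1; have := max u un; rewrite /overlap => mx.
have {}H1 := H1 ltac:(by move=> b bn; rewrite modn_rot // /u; do !case: ifP; lia).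
have {}H2 := H2 ltac:(by move=> b bn; rewrite modn_rot ?leq_subr // /u; do !case: ifP; lia).
by move: H1 H2; rewrite leqNgt; case: (n < x + t) => /=; rewrite ?muln1 ?muln0; lia.
Qed.

End Rotation.

(** * The lowest degree *)

Lemma remove_rim_hooks_nil fuel n rho :
  (remove_rim_hooks fuel n rho).2 = [::] -> (remove_rim_hooks fuel n rho).1 = rho.
Proof. by case: fuel => //= fuel; case: pickP. Qed.

Section Lowest.
Import GRing.Theory Num.Theory.
Local Open Scope ring_scope.

Variables l k : nat.
Hypotheses (l0 : (0 < l)%N) (k0 : (0 < k)%N).
Local Notation n := (l + k)%N.

Lemma core_id rho : is_part rho -> (head 0 rho <= k)%N ->
  r_ n rho = 0%N -> core n rho = rho /\ hook_sign k n rho = 1.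
Proof.
move=> pr hr r0; have e : hook_widths n rho = [::].
  by apply: size0nil; rewrite size_hook_widths.
by split; [apply: remove_rim_hooks_nil | rewrite /hook_sign e big_nil].
Qed.

Lemma r_rect nu : in_rect l k nu -> r_ n nu = 0%N.
Proof.
move=> rnu; have /and3P[pn _ hn] := rnu; have n0 : (0 < n)%N by rewrite addn_gt0 l0.
rewrite -size_hook_widths // /hook_widths; case: (sumn nu) => //= fuel.
case: pickP => //= R /andP[h1 h2]; exfalso.
have [_ _ _ mv] := rim_hook_bead_move pn n0 h1 h2.
have [c [d [/andP[cd dk] _ nc _ _]]] := bead_move_cycle pn hn mv.
by have := bead_lt l0 k0 rnu (leq_ltn_trans cd dk); rewrite ltnNge nc.
Qed.

(** The sizes leave no room for a removal, so [nu] itself is the only partition in the sum with core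
    [nu]. *)
Lemma hook_coeff_top c lam mu nu : in_rect l k nu -> sumn nu = (sumn lam + sumn mu)%N ->
  hook_coeff c l k lam mu nu = (c lam mu nu)%:Z.
Proof.
move=> rnu e; have /and3P[pn _ hn] := rnu; have [cn hs] := core_id pn hn (r_rect rnu).
rewrite /hook_coeff -big_filter (_ : [seq rho <- _ | _] = [:: nu]).
  by rewrite big_seq1 hs r_rect // mul0n expr0 !mul1r.
apply: perm_small_eq => //; apply: uniq_perm => //; first exact/filter_uniq/partitions_uniq.
move=> rho; rewrite mem_filter mem_partitions inE; apply/idP/eqP => [|->].
  case/andP=> /andP[hr /eqP ec] /andP[pr /eqP er].
  have r0 : r_ n rho = 0%N.
    have := sumn_core l0 pr hr; rewrite ec er -e -{1}[sumn nu]addn0 => /addnI/esym/eqP.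
    by rewrite muln_eq0 addn_eq0 (gtn_eqF l0) orbF => /eqP.
  by have [<-] := core_id pr hr r0; rewrite ec.
by rewrite hn cn eqxx pn e /=.
Qed.

Variable c : seq nat -> seq nat -> seq nat -> nat.
Hypothesis LRc : LR_coefficients c.
Variables lam mu : seq nat.
Hypotheses (rlam : in_rect l k lam) (rmu : in_rect l k mu).

Let plam : is_part lam. Proof. by case/and3P: rlam. Qed.
Let pmu : is_part mu. Proof. by case/and3P: rmu. Qed.

(** The coefficient of [q ^ d] times the Schubert class of [nu] in the rim hook formula. *)
Definition degree_coeff (d : nat) (nu : seq nat) : int :=
  \sum_(rho <- candidates k lam mu | [&& in_P l k lam mu c rho, r_ n rho == d & core n rho == nu])
    hook_sign k n rho * (c lam mu rho)%:Z.

Lemma in_P_sumn rho : in_P l k lam mu c rho -> sumn rho = (sumn lam + sumn mu)%N.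
Proof. by case/and4P=> pr _ nz _; apply: (LR_sumn LRc). Qed.

Lemma hook_coeff_degree nu d : in_rect l k nu -> (sumn nu + d * n)%N = (sumn lam + sumn mu)%N ->
  hook_coeff c l k lam mu nu = (-1) ^+ (d * k.-1) * degree_coeff d nu.
Proof.
move=> rnu e; rewrite /hook_coeff /degree_coeff mulr_sumr.
rewrite (bigID (fun rho => c lam mu rho != 0%N)) /= [X in _ + X]big1 ?addr0; last first.
  by move=> rho /andP[_ /negPn/eqP->]; rewrite mulr0.
rewrite -big_filter -[RHS]big_filter.
set s1 := filter _ _; set s2 := filter _ _.
have M1 rho : (rho \in s1) = ((head 0 rho <= k)%N && (core n rho == nu) && (c lam mu rho != 0%N))
    && (is_part rho && (sumn rho == sumn lam + sumn mu)%N).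
  by rewrite mem_filter mem_partitions.
have M2 rho : (rho \in s2) = [&& in_P l k lam mu c rho, r_ n rho == d & core n rho == nu]
    && in_rect (sumn lam + sumn mu) k rho.
  by rewrite mem_filter mem_shapes.
have E rho : rho \in s1 -> r_ n rho = d.
  rewrite M1 => /andP[/andP[/andP[hr /eqP ec] nz] /andP[pr /eqP er]].
  have := sumn_core l0 pr hr; rewrite ec er -e => /addnI/eqP.
  by rewrite eqn_pmul2r ?addn_gt0 ?l0 // => /eqP.
have pe : perm_eq s2 s1.
  apply: uniq_perm; [exact/filter_uniq/shapes_uniq|exact/filter_uniq/partitions_uniq|].
  move=> rho; apply/idP/idP => h; last first.
    have er := E _ h; move: h; rewrite M1 M2.
    case/andP=> /andP[/andP[hr /eqP ec] nz] /andP[pr /eqP es].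
    by rewrite /in_P er ec rnu pr hr nz !eqxx /in_rect pr hr -es size_le_sumn.
  move: h; rewrite M1 M2 => /andP[/and3P[P _ ec] _].
  by have /and4P[pr hr nz _] := P; rewrite hr ec nz pr (in_P_sumn P) /=.
rewrite [RHS](perm_big _ pe); apply: eq_big_seq => rho /E->.
by rewrite mulrA [(-1) ^+ _ * _]mulrC.
Qed.

Lemma alt_rotate (y : 'I_k -> algC) nu nu' t (s : 'S_k) : (forall j, y j ^+ n = 1) ->
  (forall i : 'I_k, bead k nu' i = (bead k nu (s i) + t) %% n)%N ->
  alt y (bead k nu') = (\prod_j y j) ^+ t * ((-1) ^+ s * alt y (bead k nu)).
Proof.
move=> yn h; rewrite -alt_perm !altE mulr_sumr; apply: eq_bigr => s' _.
rewrite mulrCA; congr (_ * _); rewrite -prodrXl [X in X * _](reindex_inj (@perm_inj _ s')).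
rewrite -big_split; apply: eq_bigr => i _ /=.
by rewrite h (expr_mod _ (yn _)) exprD mulrC.
Qed.

(** Apply [LR_lower] to the transposes at the last beads counted by [a] and [b]. The staircase terms
    add up exactly, so bead [a + b - 1 - k] of [rho] is at least [n], as are all beads before it. *)
Lemma overlap_le_r t rho : (t <= n)%N -> in_P l k lam mu c rho ->
  (overlap l k lam mu t - k <= r_ n rho)%N.
Proof.
move=> tn P; have /and4P[pr hr nz rc] := P; rewrite /overlap.
set a := above k lam _; set b := above k mu _.
have [|lt] := leqP (a + b) k; first by rewrite -subn_eq0 => /eqP->.
have ak : (a <= k)%N := above_le _ _ _; have bk : (b <= k)%N := above_le _ _ _.
have := big_beads_core l0 pr hr; rewrite (big_beads_rect l0 k0 rc) add0n; apply: leq_trans.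
have nz' : c (conjp lam) (conjp mu) (conjp rho) != 0%N by rewrite LR_conjp.
have := @LR_lower c LRc k _ _ _ a.-1 b.-1 (conjp_part plam) (conjp_part pmu) (conjp_part pr) _ nz'.
rewrite size_conjp !nth_conjp // => /(_ hr ltac:(lia) ltac:(lia) ltac:(lia)) le.
have ha : (n - t <= bead k lam a.-1)%N by apply: above_bead; rewrite prednK //; lia.
have hb : (t <= bead k mu b.-1)%N by apply: above_bead; rewrite prednK //; lia.
have hD : (n <= bead k rho (a.-1 + b.-1.+1 - k))%N.
  by move: ha hb; rewrite /bead; move: le ak bk lt tn; clear; lia.
have := @bead_above k rho n _ _ hD; rewrite /above -/(big_beads k n rho).
by move=> h; have := h ltac:(lia); lia.
Qed.

Lemma lowest_degree : exists D nu, [/\ in_rect l k nu, degree_coeff D nu != 0,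
  (forall rho, in_P l k lam mu c rho -> (D <= r_ n rho)%N) & (D <= sumn lam + sumn mu)%N].
Proof.
have [t _ max] := @arg_maxnP 'I_n.+1 ord0 xpredT (fun t => overlap l k lam mu t) isT.
have tn : (t <= n)%N by rewrite -ltnS.
have {}max u : (u <= n)%N -> (overlap l k lam mu u <= overlap l k lam mu t)%N.
  by move=> un; have := max (Ordinal (un : u < n.+1)%N) isT.
have [lam' [mu' [s [s' [[rl rm] h h' sz fit]]]]] := rotate_pair l0 k0 rlam rmu tn max.
have /and3P[pl _ hl] := rl; have /and3P[pm _ hm] := rm; have /and3P[_ sl _] := rl; have /and3P[_ sm _] := rm.
(* The transposes live in the rectangle with [k] rows and [l] columns, where the fit of the rotated
   pair is the hypothesis of [LR_box]. *)
have [|||||||sig [ps ss hs nz]] := @LR_box c LRc k l (conjp lam') (conjp mu').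
- exact: conjp_part.
- exact: conjp_part.
- by rewrite size_conjp.
- by rewrite size_conjp.
- by rewrite head_conjp.
- by rewrite head_conjp.
- by move=> i ik; rewrite !nth_conjp //; apply: fit.
set nu := conjp sig.
have rnu : in_rect l k nu by rewrite /in_rect conjp_part // size_conjp head_conjp // hs ss.
have pnu : is_part nu by exact: conjp_part.
have nz' : c lam' mu' nu != 0%N by rewrite -(LR_conjp LRc) // /nu conjpK.
have snu : sumn nu = (sumn lam' + sumn mu')%N by apply: (LR_sumn LRc).
have altE (y : 'I_k -> algC) : (forall j, y j ^+ n = 1) ->
    alt y (bead k lam') * alt y (bead k mu') =
    (-1) ^+ (odd_perm s (+) odd_perm s') * (alt y (bead k lam) * alt y (bead k mu)).
  move=> yn; rewrite (alt_rotate yn h) (alt_rotate yn h') mulrACA -exprD subnKC //.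
  rewrite -prodrXl big1 ?mul1r; last by move=> j _; apply: yn.
  by rewrite mulrACA -signr_addb.
(* For the rotated pair the coefficient of [nu] is a positive number; for the original pair it is,
   up to sign, the coefficient of the degree that the loss of size under rotation dictates. *)
have := hook_coeff_eq LRc l0 k0 rlam rmu rl rm altE rnu.
rewrite hook_coeff_top // (@hook_coeff_degree nu (overlap l k lam mu t - k)) //; last first.
  by rewrite snu mulnC.
move=> E; exists (overlap l k lam mu t - k)%N, nu; split=> //.
- apply/eqP => e0; move: E; rewrite e0 !mulr0 => /eqP.
  by rewrite eqz_nat (negbTE nz').
- by move=> rho; apply: overlap_le_r.
by move: sz l0; nia.
Qed.

End Lowest.

(** * Coefficients of the rim hook formula and of the quantum product *)

Section Conclusion.
Import GRing.Theory Num.Theory.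
Local Open Scope ring_scope.
Variables (l k : nat) (lam mu : seq nat) (c : seq nat -> seq nat -> seq nat -> nat).
Local Notation n := (l + k)%N.

Lemma lowest_contributionE d (x : seq_sub (shapes l k)) :
  lowest_contribution l k lam mu c d x = (degree_coeff l k c lam mu d (val x))%:P.
Proof.
rewrite /lowest_contribution sum_ffunE /degree_coeff rmorph_sum.
under [RHS]eq_bigl => rho do rewrite andbA.
rewrite [RHS]big_mkcondr /=; apply: eq_bigr => rho _; rewrite !ffunE.
rewrite eq_sym; case: eqP => _ /=.
  by rewrite /signed_coeff -[LHS]/(_ * _) mulr1.
by rewrite -[LHS]/(_ * _) mulr0.
Qed.

Lemma rim_hook_sum_coeff d (x : seq_sub (shapes l k)) :
  ((\sum_(rho <- candidates k lam mu | in_P l k lam mu c rho)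
    ('X^(r_ n rho) * signed_coeff l k lam mu c rho) *: sigma l k (core n rho)) x)`_d =
  degree_coeff l k c lam mu d (val x).
Proof.
rewrite sum_ffunE coef_sum /degree_coeff.
rewrite [RHS]big_mkcondr /=; apply: eq_bigr => rho _; rewrite !ffunE.
rewrite -[_ *: _]/(_ * _) /signed_coeff; case: (core n rho =P val x) => [->|ne].
  rewrite eqxx mulr1 andbT coefMC coefXn eq_sym; case: eqP => _; by rewrite ?mul1r ?mul0r.
by rewrite andbF eq_sym; case: eqP => // _; rewrite mulr0 coef0.
Qed.

Lemma quantum_product_coeff GW d (x : seq_sub (shapes l k)) : (d <= sumn lam + sumn mu)%N ->
  (quantum_product l k lam mu GW x)`_d = (GW lam mu (dual_part l k (val x)) d)%:Z.
Proof.
move=> le; rewrite /quantum_product sum_ffunE coef_sum.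
rewrite (bigD1_seq (val x)) ?shapes_uniq ?ssvalP //= [X in _ + X]big1 ?addr0; last first.
  move=> nu ne; rewrite sum_ffunE big1 ?coef0 // => i _; rewrite !ffunE.
  by rewrite eq_sym (negbTE ne) -[_ *: _]/(_ * _) mulr0.
rewrite sum_ffunE coef_sum; have lt : (d < (sumn lam + sumn mu).+1)%N by [].
rewrite (bigD1 (Ordinal lt)) //= big1 ?addr0.
  by rewrite !ffunE eqxx -[_ *: _]/(_ * _) mulr1 coefMn coefXn eqxx natz.
move=> i; rewrite -val_eqE /= => ne; rewrite !ffunE eqxx -[_ *: _]/(_ * _) mulr1.
by rewrite coefMn coefXn eq_sym (negbTE ne) mul0rn.
Qed.

End Conclusion.

Theorem theorem1p1 (l k : nat) (lam mu : seq nat)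
    (c : seq nat -> seq nat -> seq nat -> nat) :
  (1 <= l)%N -> (1 <= k)%N -> in_rect l k lam -> in_rect l k mu ->
  LR_coefficients c ->
  exists r0 : nat,
    [/\ is_r0 l k lam mu c r0,
        (forall rho, in_P l k lam mu c rho ->
           (r_ (l + k) rho = r0 <->
            forall rho', in_P l k lam mu c rho' ->
              (sumn (core (l + k) rho') <= sumn (core (l + k) rho))%N)),
        lowest_contribution l k lam mu c r0 <> 0%R
      & (forall (R : realType) (GW : seq nat -> seq nat -> seq nat -> nat -> nat),
           GW_invariants R l k GW ->
           rim_hook_formula l k lam mu c GW ->
           is_dmin l k lam mu GW r0)].
Proof.
move=> l0 k0 rlam rmu LRc.
have [D [nu [rnu nz minD leD]]] := lowest_degree l0 k0 LRc rlam rmu.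
have sc rho : in_P l k lam mu c rho ->
    sumn lam + sumn mu = sumn (core (l + k) rho) + r_ (l + k) rho * (l + k).
  move=> P; have /and4P[pr hr _ _] := P; rewrite -(in_P_sumn LRc rlam rmu P).
  exact: sumn_core.
(* A nonzero sum has a summand, so [D] is attained on [P]. *)
have [rho0 P0 e0] : exists2 rho, in_P l k lam mu c rho & r_ (l + k) rho = D.
  have [/hasP[rho _ /andP[P /eqP e]]|/hasPn no] := boolP (has
    (fun rho => in_P l k lam mu c rho && (r_ (l + k) rho == D)) (candidates k lam mu)).
    by exists rho.
  case/eqP: nz; rewrite /degree_coeff big_seq_cond big1 // => rho.
  by move=> /andP[/no + /and3P[P e _]]; rewrite P e.
have n0 : 0 < l + k by rewrite addn_gt0 l0.
exists D; split.
- by split=> //; exists rho0.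
(* By [sc] the size of the core plus [l + k] times the number of hooks is constant on [P], so fewest
   hooks means largest core. *)
- move=> rho P; split=> [e rho' P'|mx].
    have := sc _ P; rewrite (sc _ P') e => E.
    have := leq_mul (minD _ P') (leqnn (l + k)); lia.
  have := mx _ P0; have := minD _ P; have := sc _ P; rewrite (sc _ P0) e0 => E h1 h2.
  by apply/eqP; rewrite eqn_leq h1 andbT -(leq_pmul2r n0); lia.
- have mnu : nu \in shapes l k by rewrite mem_shapes.
  move/ffunP/(_ (SeqSub mnu)); rewrite lowest_contributionE ffunE => /eqP.
  by rewrite polyC_eq0 (negbTE nz).
move=> R GW _ rhf.
have GWE d nu' : in_rect l k nu' -> d <= sumn lam + sumn mu ->
    Posz (GW lam mu (dual_part l k nu') d) = degree_coeff l k c lam mu d nu'.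
  move=> r le; have mnu : nu' \in shapes l k by rewrite mem_shapes.
  have /ffunP/(_ (SeqSub mnu))/(congr1 (fun p : {poly int} => nth 0%R p d)) := rhf.
  by rewrite quantum_product_coeff // rim_hook_sum_coeff.
split; first by exists nu => // e; move: nz; rewrite -GWE // e.
(* A degree below [D] is also at most [sumn lam + sumn mu], so it is among those kept in
   [quantum_product]; there the rim hook sum is empty. *)
move=> d nu' r GWnz; rewrite leqNgt; apply/negP => lt; case: GWnz.
have := GWE d nu' r (ltnW (leq_trans lt leD)).
rewrite /degree_coeff big1 => [[]//|rho /and3P[P /eqP e _]].
by have := minD rho P; rewrite e leqNgt lt.
Qed.
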